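(* Let $m,n\in\mathbb{N}_0$ with $m\neq n$, and let $\Phi$ be an algebraically closed field of characteristic $0$. There exist no simple finite-dimensional Filippov superalgebras (of any arity $N\ge 3$, with nonzero even and odd parts) of type $A(m,n)$ over $\Phi$.
   Context: $\mathbb{N}_0=\{0,1,2,\dots\}$. An $N$-ary Filippov superalgebra over a field $k$ is a $\mathbb{Z}_2$-graded vector space $\mathcal{F}=\mathcal{F}_{\bar 0}\oplus\mathcal{F}_{\bar 1}$ over $k$ with an $N$-linear operation $[\cdot,\ldots,\cdot]$ such that $[\mathcal{F}_{\alpha_1},\ldots,\mathcal{F}_{\alpha_N}]\subseteq\mathcal{F}_{\alpha_1+\cdots+\alpha_N}$ and, for homogeneous elements (with $p(x)$ denoting the parity of $x$), $$[x_1,\ldots,x_{i-1},x_i,\ldots,x_N]=-(-1)^{p(x_{i-1})p(x_i)}[x_1,\ldots,x_i,x_{i-1},\ldots,x_N],$$ $$[[x_1,\ldots,x_N],y_2,\ldots,y_N]=\sum_{i=1}^N(-1)^{p\bar q_i}[x_1,\ldots,[x_i,y_2,\ldots,y_N],\ldots,x_N],$$ where $p=\sum_{i=2}^Np(y_i)$, $\bar q_i=\sum_{j=i+1}^Np(x_j)$, $\bar q_N=0$. An ideal of $\mathcal{F}$ is a $\mathbb{Z}_2$-graded subspace $I$ with $[I,\mathcal{F},\ldots,\mathcal{F}]\subseteq I$. $\mathcal{F}$ is simple if $[\mathcal{F},\ldots,\mathcal{F}]\neq 0$ and $\mathcal{F}$ has no ideals other than $0$ and $\mathcal{F}$. For homogeneous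 $x_1,\ldots,x_{N-1}\in\mathcal{F}$ and $i\in\{1,\ldots,N\}$ let $ad_i(x_1,\ldots,x_{N-1})\in End(\mathcal{F})$ be given by $ad_i(x_1,\ldots,x_{N-1})x=(-1)^{p(x)q_i}[x_1,\ldots,x_{i-1},x,x_i,\ldots,x_{N-1}]$, $q_i=\sum_{j=i}^{N-1}p(x_j)$. $Inder(\mathcal{F})$ is the linear span of all these operators; it is a Lie superalgebra under the supercommutator $[a,b]=ab-(-1)^{\deg(a)\deg(b)}ba$. $\mathcal{F}$ is said to have type $G$, for a Lie superalgebra $G$, if $Inder(\mathcal{F})\cong G$. For $m\neq n$, $A(m,n)=sl(m+1,n+1)$ is the Lie superalgebra (under the supercommutator) of block matrices $\begin{pmatrix}A&B\\C&D\end{pmatrix}$ with $A$ of size $(m+1)\times(m+1)$, $D$ of size $(n+1)\times(n+1)$, and $tr(A)=tr(D)$; the even part is $B=C=0$ and the odd part is $A=D=0$. *)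

(* Defs.v *)
From HB Require Import structures.
From mathcomp Require Import all_boot all_order all_algebra.
From mathcomp Require Import ring.

Set Implicit Arguments.
Unset Strict Implicit.
Unset Printing Implicit Defensive.

Import GRing.Theory.
Local Open Scope ring_scope.

(* Parities are booleans: [false] is even, [true] is odd, and [addb], written
   [(+)], is addition in Z/2. *)
Record superspace (k : fieldType) := Superspace {
  scarrier :> vectType k;
  homog : bool -> {vspace scarrier};
  homog_add : (homog false + homog true)%VS = fullv;
  homog_cap : (homog false :&: homog true)%VS = 0%VS }.

Arguments homog {k} V d : rename.

(* [upd x i v] is (x_1, ..., x_(i-1), v, x_(i+1), ..., x_N). *)
Definition upd (T : Type) (N : nat) (x : {ffun 'I_N -> T}) (i : 'I_N) (v : T) :
    {ffun 'I_N -> T} :=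
  [ffun j => if j == i then v else x j].

(* [ins i v x] is (x_1, ..., x_(i-1), v, x_i, ..., x_(N-1)). *)
Definition ins (T : Type) (N : nat) (i : 'I_N) (v : T)
    (x : {ffun 'I_N.-1 -> T}) : {ffun 'I_N -> T} :=
  [ffun j => if unlift i j is Some j' then x j' else v].

(* [homogs p x]: each x_i is homogeneous, of parity p_i. The parity is carried
   along explicitly because 0 has both parities. *)
Definition homogs (k : fieldType) (V : superspace k) (N : nat)
    (p : 'I_N -> bool) (x : {ffun 'I_N -> V}) : Prop :=
  forall i, x i \in homog V (p i).

(* Indices start at 0, so the first slot is the [i0 : 'I_N] of value 0. *)
Record filippovSuperalgebra (k : fieldType) (N : nat) := FilippovSuperalgebra {
  fcarrier :> superspace k;
  fbr : {ffun 'I_N -> fcarrier} -> fcarrier;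
  fbr_linear : forall (x : {ffun 'I_N -> fcarrier}) (i : 'I_N) (a : k) u v,
    fbr (upd x i (a *: u + v)) = a *: fbr (upd x i u) + fbr (upd x i v);
  fbr_homog : forall p (x : {ffun 'I_N -> fcarrier}), homogs p x ->
    fbr x \in homog fcarrier (\big[addb/false]_i p i);
  fbr_skew : forall p (x : {ffun 'I_N -> fcarrier}) (i j : 'I_N),
    homogs p x -> j = i.+1 :> nat ->
    fbr x = - ((-1) ^+ (p i * p j) *: fbr (upd (upd x i (x j)) j (x i)));
  fbr_filippov : forall (i0 : 'I_N) p q (x : {ffun 'I_N -> fcarrier})
      (y : {ffun 'I_N.-1 -> fcarrier}),
    i0 = 0%N :> nat -> homogs p x -> homogs q y ->
    fbr (ins i0 (fbr x) y) =
      \sum_(i < N) (-1) ^+ ((\sum_j q j) * (\sum_(j < N | (i < j)%N) p j))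
                     *: fbr (upd x i (fbr (ins i0 (x i) y))) }.

Definition gradedv (k : fieldType) (V : superspace k) (U : {vspace V}) : Prop :=
  U = ((U :&: homog V false) + (U :&: homog V true))%VS.

Definition fideal (k : fieldType) (N : nat) (F : filippovSuperalgebra k N)
    (I : {vspace F}) : Prop :=
  gradedv I /\
  forall (i0 : 'I_N) (x : {ffun 'I_N -> F}),
    i0 = 0%N :> nat -> x i0 \in I -> fbr x \in I.

Definition fsimple (k : fieldType) (N : nat) (F : filippovSuperalgebra k N) :
    Prop :=
  (exists x : {ffun 'I_N -> F}, fbr x <> 0) /\
  forall I : {vspace F}, fideal I -> I = 0%VS \/ I = fullv.

Definition hproj (k : fieldType) (V : superspace k) (d : bool) : 'End(V) :=
  daddv_pi (homog V d) (homog V (~~ d)).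

(* [p] lists the parities of [x]. The formula for ad_i on homogeneous vectors,
   recovered in [adE], is extended linearly through the projections. *)
Definition ad_fun (k : fieldType) (N : nat) (F : filippovSuperalgebra k N)
    (i : 'I_N) (p : 'I_N.-1 -> bool) (x : {ffun 'I_N.-1 -> F}) (v : F) : F :=
  \sum_(d : bool) (-1) ^+ (d * (\sum_(j < N.-1 | (i <= j)%N) p j))
                    *: fbr (ins i (hproj F d v) x).

Lemma ins_upd (T : Type) (N : nat) (u v : T) (i : 'I_N)
    (x : {ffun 'I_N.-1 -> T}) : ins i v x = upd (ins i u x) i v.
Proof.
apply/ffunP => j; rewrite !ffunE; case: unliftP => [j' ->|->].
  by rewrite eq_sym (negPf (neq_lift _ _)).
by rewrite eqxx.
Qed.

Lemma fbr_ins_linear (k : fieldType) (N : nat) (F : filippovSuperalgebra k N)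
    (i : 'I_N) (x : {ffun 'I_N.-1 -> F}) :
  linear (fun v : F => fbr (ins i v x)).
Proof.
move=> a u v; rewrite (ins_upd 0 (a *: u + v)) fbr_linear.
by rewrite -(ins_upd 0 u) -(ins_upd 0 v).
Qed.

Lemma ad_fun_is_linear (k : fieldType) (N : nat)
    (F : filippovSuperalgebra k N) (i : 'I_N) (p : 'I_N.-1 -> bool)
    (x : {ffun 'I_N.-1 -> F}) : linear (ad_fun i p x).
Proof.
move=> a u v; rewrite /ad_fun scaler_sumr -big_split /=; apply: eq_bigr => d _.
rewrite (linearP (hproj F d)) fbr_ins_linear scalerDr !scalerA.
by rewrite [a * _]mulrC.
Qed.

HB.instance Definition _ (k : fieldType) (N : nat)
    (F : filippovSuperalgebra k N) (i : 'I_N) (p : 'I_N.-1 -> bool)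
    (x : {ffun 'I_N.-1 -> F}) :=
  GRing.isLinear.Build k F F _ (ad_fun i p x) (ad_fun_is_linear i p x).

Definition ad (k : fieldType) (N : nat) (F : filippovSuperalgebra k N)
    (i : 'I_N) (p : 'I_N.-1 -> bool) (x : {ffun 'I_N.-1 -> F}) : 'End(F) :=
  linfun (ad_fun i p x).

Lemma homog_capN (k : fieldType) (V : superspace k) (d : bool) :
  (homog V d :&: homog V (~~ d))%VS = 0%VS.
Proof. by case: d; rewrite /= ?homog_cap // capvC homog_cap. Qed.

Lemma homog_addN (k : fieldType) (V : superspace k) (d : bool) :
  (homog V d + homog V (~~ d))%VS = fullv.
Proof. by case: d; rewrite /= ?homog_add // addvC homog_add. Qed.

Lemma hproj_id (k : fieldType) (V : superspace k) (d : bool) (v : V) :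
  v \in homog V d -> hproj V d v = v.
Proof. by move=> hv; apply: daddv_pi_id => //; apply: homog_capN. Qed.

Lemma hproj_id0 (k : fieldType) (V : superspace k) (d : bool) (v : V) :
  v \in homog V d -> hproj V (~~ d) v = 0.
Proof.
move=> hv; have vV : v \in (homog V d + homog V (~~ d))%VS.
  by rewrite homog_addN memvf.
have := daddv_pi_add (homog_capN V d) vV.
rewrite /hproj negbK [X in X + _]hproj_id // => /(canRL (addKr _)).
by rewrite addNr.
Qed.

Lemma adE (k : fieldType) (N : nat) (F : filippovSuperalgebra k N)
    (i : 'I_N) (p : 'I_N.-1 -> bool) (x : {ffun 'I_N.-1 -> F}) (d : bool)
    (v : F) : v \in homog F d ->
  ad i p x v =
    (-1) ^+ (d * (\sum_(j < N.-1 | (i <= j)%N) p j)) *: fbr (ins i v x).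
Proof.
move=> hv; rewrite /ad lfunE /= /ad_fun (bigD1 d) //= hproj_id //.
rewrite [X in _ + X]big1 ?addr0 // => e ed.
have -> : e = ~~ d by case: e d ed {hv} => -[].
rewrite hproj_id0 //.
have := fbr_ins_linear i x (-1) 0 0.
by rewrite scaler0 add0r scaleN1r addNr => ->; rewrite scaler0.
Qed.

Definition is_ad (k : fieldType) (N : nat) (F : filippovSuperalgebra k N)
    (f : 'End(F)) : Prop :=
  exists (i : 'I_N) (p : 'I_N.-1 -> bool) (x : {ffun 'I_N.-1 -> F}),
    homogs p x /\ f = ad i p x.

Definition Inder (k : fieldType) (N : nat) (F : filippovSuperalgebra k N)
    (f : 'End(F)) : Prop :=
  exists s : seq 'End(F), (forall g, g \in s -> is_ad g) /\ f \in <<s>>%VS.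

Definition end_homog (k : fieldType) (V : superspace k) (d : bool)
    (f : 'End(V)) : Prop :=
  forall e v, v \in homog V e -> f v \in homog V (d (+) e).

Record lieSuperalgebra (k : fieldType) := LieSuperalgebra {
  lcarrier :> superspace k;
  lbr : lcarrier -> lcarrier -> lcarrier;
  lbr_linearl : forall c, linear (lbr^~ c);
  lbr_linearr : forall a, linear (lbr a);
  lbr_homog : forall d e a b,
    a \in homog lcarrier d -> b \in homog lcarrier e ->
    lbr a b \in homog lcarrier (d (+) e);
  lbr_skew : forall d e a b,
    a \in homog lcarrier d -> b \in homog lcarrier e ->
    lbr a b = - ((-1) ^+ (d * e) *: lbr b a);
  lbr_jacobi : forall d e g a b c,
    a \in homog lcarrier d -> b \in homog lcarrier e ->
    c \in homog lcarrier g ->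
    lbr a (lbr b c) = lbr (lbr a b) c + (-1) ^+ (d * e) *: lbr b (lbr a c) }.

(* [Inder F] and [G] are isomorphic: [phi] is an injective even homomorphism
   from [G] to the endomorphisms of [F] under the supercommutator, with image
   [Inder F]. *)
Definition has_type (k : fieldType) (N : nat) (F : filippovSuperalgebra k N)
    (G : lieSuperalgebra k) : Prop :=
  exists phi : 'Hom(G, 'End(F)),
    [/\ lker phi = 0%VS,
        forall f : 'End(F), f \in limg phi <-> Inder f,
        forall d a, a \in homog G d -> end_homog d (phi a)
      & forall d e a b, a \in homog G d -> b \in homog G e ->
          phi (lbr a b) =
            (phi a \o phi b)%VF - (-1) ^+ (d * e) *: (phi b \o phi a)%VF].

Section SpecialLinear.

Variables (k : fieldType) (m n : nat).
Local Notation M := 'M[k]_(m.+1 + n.+1).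

Definition mxpart (d : bool) (X : M) : M :=
  if d then block_mx 0 (ursubmx X) (dlsubmx X) 0
  else block_mx (ulsubmx X) 0 0 (drsubmx X).

#[local] Arguments mxpart : simpl never.

Definition supertrace (X : M) : k^o := \tr (ulsubmx X) - \tr (drsubmx X).

(* [X, Y] = XY - (-1)^(deg X deg Y) YX on homogeneous matrices, see [scommE],
   extended bilinearly. *)
Definition scomm (X Y : M) : M :=
  \sum_(d : bool) \sum_(e : bool)
    (mxpart d X *m mxpart e Y - (-1) ^+ (d * e) *: (mxpart e Y *m mxpart d X)).

Lemma mxpart_is_linear d : linear (mxpart d).
Proof.
move=> a X Y; rewrite /mxpart; case: d;
  rewrite scale_block_mx add_block_mx !scaler0 !addr0;
  by congr block_mx; apply/matrixP => i j; rewrite !mxE.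
Qed.
HB.instance Definition _ d :=
  GRing.isLinear.Build k M M _ (mxpart d) (mxpart_is_linear d).

Lemma supertrace_is_linear : linear supertrace.
Proof.
move=> a X Y; rewrite /supertrace.
have -> : ulsubmx (a *: X + Y) = a *: ulsubmx X + ulsubmx Y.
  by apply/matrixP => i j; rewrite !mxE.
have -> : drsubmx (a *: X + Y) = a *: drsubmx X + drsubmx Y.
  by apply/matrixP => i j; rewrite !mxE.
by rewrite !mxtraceD !mxtraceZ scalerBr opprD addrACA.
Qed.
HB.instance Definition _ :=
  GRing.isLinear.Build k M k^o _ supertrace supertrace_is_linear.

Lemma mxpart_add X : mxpart false X + mxpart true X = X.
Proof. by rewrite /mxpart add_block_mx !addr0 !add0r submxK. Qed.

Lemma mxpartK d e X : mxpart d (mxpart e X) = if d == e then mxpart d X else 0.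
Proof.
by case: d e => -[]; rewrite /mxpart ?block_mxKul ?block_mxKur ?block_mxKdl
  ?block_mxKdr ?block_mx0.
Qed.

(* A block matrix belongs to [slv] when tr(A) = tr(D). *)
Definition slv : {vspace M} := lker (linfun supertrace).

Lemma mem_slv X : (X \in slv) = (\tr (ulsubmx X) == \tr (drsubmx X)).
Proof. by rewrite memv_ker lfunE /= /supertrace subr_eq0. Qed.

Lemma mxpart_slv d X : X \in slv -> mxpart d X \in slv.
Proof.
rewrite !mem_slv /mxpart; case: d => /eqP.
  by rewrite block_mxKul block_mxKdr !mxtrace0.
by rewrite block_mxKul block_mxKdr => ->.
Qed.

Lemma supertrace_mulC d e X Y :
  supertrace (mxpart d X *m mxpart e Y) =
  (-1) ^+ (d * e) *: supertrace (mxpart e Y *m mxpart d X).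
Proof.
rewrite /supertrace /mxpart; case: d e => -[] /=;
  rewrite !mulmx_block !block_mxKul !block_mxKdr !(mul0mx, mulmx0, addr0, add0r)
    ?(mxtrace0, subrr, scaler0, scale1r, scaleN1r, opprB) //.
- by rewrite [X in X - _]mxtrace_mulC [X in _ - X]mxtrace_mulC.
- by rewrite [X in X - _]mxtrace_mulC [X in _ - X]mxtrace_mulC.
Qed.

Lemma scomm_sl X Y : scomm X Y \in slv.
Proof.
rewrite memv_ker lfunE /= /scomm !linear_sum big1 // => d _.
rewrite linear_sum big1 // => e _.
by rewrite linearB linearZ /= supertrace_mulC subrr.
Qed.

Lemma scomm_is_linearl Y : linear (scomm^~ Y).
Proof.
move=> a X Z; rewrite /scomm scaler_sumr -big_split; apply: eq_bigr => d _ /=.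
rewrite scaler_sumr -big_split; apply: eq_bigr => e _ /=.
rewrite (linearP (mxpart d)) mulmxDl mulmxDr -scalemxAl -scalemxAr.
rewrite [in LHS]scalerDr opprD addrACA [in RHS]scalerBr !scalerA.
by rewrite [in RHS](mulrC a).
Qed.

Lemma scomm_is_linearr X : linear (scomm X).
Proof.
move=> a Y Z; rewrite /scomm scaler_sumr -big_split; apply: eq_bigr => d _ /=.
rewrite scaler_sumr -big_split; apply: eq_bigr => e _ /=.
rewrite (linearP (mxpart e)) mulmxDl mulmxDr -scalemxAl -scalemxAr.
rewrite [in LHS]scalerDr opprD addrACA [in RHS]scalerBr !scalerA.
by rewrite [in RHS](mulrC a).
Qed.

Lemma mxpart_homog d X : mxpart (~~ d) X = 0 -> mxpart d X = X.
Proof.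
by have := mxpart_add X; case: d => /= + X0; rewrite X0 ?addr0 ?add0r.
Qed.

Lemma scommE d e X Y : mxpart (~~ d) X = 0 -> mxpart (~~ e) Y = 0 ->
  scomm X Y = X *m Y - (-1) ^+ (d * e) *: (Y *m X).
Proof.
move=> hX hY; rewrite /scomm (bigD1 d) //= [X in _ + X]big1 ?addr0; last first.
  move=> i id; have -> : i = ~~ d by case: i d id {hX} => -[].
  by apply: big1 => j _; rewrite hX mul0mx mulmx0 scaler0 subrr.
rewrite (bigD1 e) //= [X in _ + X]big1 ?addr0; last first.
  move=> i ie; have -> : i = ~~ e by case: i e ie {hY} => -[].
  by rewrite hY mul0mx mulmx0 scaler0 subrr.
by rewrite (mxpart_homog hX) (mxpart_homog hY).
Qed.

Lemma mxpart_mul d e X Y : mxpart (~~ d) X = 0 -> mxpart (~~ e) Y = 0 ->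
  mxpart (~~ (d (+) e)) (X *m Y) = 0.
Proof.
move=> /mxpart_homog <- /mxpart_homog <-; case: d e => -[] /=;
  by rewrite /mxpart mulmx_block !(mul0mx, mulmx0, addr0, add0r)
    ?(block_mxKul, block_mxKur, block_mxKdl, block_mxKdr) block_mx0.
Qed.

Lemma scomm_homog d e X Y : mxpart (~~ d) X = 0 -> mxpart (~~ e) Y = 0 ->
  mxpart (~~ (d (+) e)) (scomm X Y) = 0.
Proof.
move=> hX hY; rewrite (scommE hX hY) linearB linearZ /= mxpart_mul //.
by rewrite addbC mxpart_mul // scaler0 subrr.
Qed.

Lemma scomm_skew d e X Y : mxpart (~~ d) X = 0 -> mxpart (~~ e) Y = 0 ->
  scomm X Y = - ((-1) ^+ (d * e) *: scomm Y X).
Proof.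
move=> hX hY; rewrite (scommE hX hY) (scommE hY hX) scalerBr scalerA opprB.
by rewrite [(e * d)%N]mulnC -expr2 sqrr_sign scale1r.
Qed.

Lemma scomm_jacobi d e g X Y Z : mxpart (~~ d) X = 0 -> mxpart (~~ e) Y = 0 ->
    mxpart (~~ g) Z = 0 ->
  scomm X (scomm Y Z) =
    scomm (scomm X Y) Z + (-1) ^+ (d * e) *: scomm Y (scomm X Z).
Proof.
move=> hX hY hZ.
rewrite (scommE hX (scomm_homog hY hZ)) (scommE (scomm_homog hX hY) hZ).
rewrite (scommE hY (scomm_homog hX hZ)).
rewrite (scommE hY hZ) (scommE hX hY) (scommE hX hZ).
rewrite !(mulmxBl, mulmxBr) -!(scalemxAl, scalemxAr) !mulmxA.
set a := X *m Y *m Z; set b := X *m Z *m Y; set c := Y *m X *m Z.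
set a' := Y *m Z *m X; set b' := Z *m X *m Y; set c' := Z *m Y *m X.
apply/matrixP => i j; rewrite !(scalerBr, scalerA, opprB).
move: a b c a' b' c' => a b c a' b' c'; rewrite !mxE.
by case: d e g {hX hY hZ} => -[] -[]; rewrite /= ?expr0 ?expr1; ring.
Qed.

Local Notation sl := (subvs_of slv).

(* Homogeneous of parity [d] means that the blocks of the other parity are 0. *)
Definition slhomog (d : bool) : {vspace sl} :=
  lker (linfun (mxpart (~~ d) \o vsval)).

Lemma mem_slhomog d (u : sl) :
  (u \in slhomog d) = (mxpart (~~ d) (vsval u) == 0).
Proof. by rewrite memv_ker lfunE. Qed.

Lemma slhomog_add : (slhomog false + slhomog true)%VS = fullv.
Proof.
apply/eqP; rewrite eqEsubv subvf; apply/subvP => u _.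
have hu d := mxpart_slv d (subvsP u).
have -> : u = vsproj slv (mxpart false (vsval u))
              + vsproj slv (mxpart true (vsval u)).
  by apply: val_inj; rewrite /= !vsprojK // mxpart_add.
by apply: memv_add; rewrite mem_slhomog vsprojK // mxpartK.
Qed.

Lemma slhomog_cap : (slhomog false :&: slhomog true)%VS = 0%VS.
Proof.
apply/eqP; rewrite -subv0; apply/subvP => u.
rewrite memv_cap !mem_slhomog memv0 => /andP[/eqP u1 /eqP u0].
by apply/eqP/val_inj; rewrite /= -[LHS]mxpart_add u1 u0 addr0.
Qed.

Definition slspace : superspace k := Superspace slhomog_add slhomog_cap.

Definition slbr (u v : slspace) : slspace :=
  vsproj slv (scomm (vsval (u : sl)) (vsval (v : sl))).

Lemma slbrE u v :
  vsval (slbr u v : sl) = scomm (vsval (u : sl)) (vsval (v : sl)).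
Proof. by rewrite vsprojK // scomm_sl. Qed.

Lemma slbr_linearl v : linear (slbr^~ v).
Proof.
move=> a u w; apply: val_inj; rewrite /= slbrE scomm_is_linearl.
by rewrite -!slbrE.
Qed.

Lemma slbr_linearr u : linear (slbr u).
Proof.
move=> a v w; apply: val_inj; rewrite /= slbrE scomm_is_linearr.
by rewrite -!slbrE.
Qed.

Lemma slbr_homog d e (u v : slspace) :
  u \in homog slspace d -> v \in homog slspace e ->
  slbr u v \in homog slspace (d (+) e).
Proof.
rewrite /= !mem_slhomog => /eqP hu /eqP hv.
by apply/eqP; rewrite slbrE scomm_homog.
Qed.

Lemma slbr_skew d e (u v : slspace) :
  u \in homog slspace d -> v \in homog slspace e ->
  slbr u v = - ((-1) ^+ (d * e) *: slbr v u).
Proof.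
rewrite /= !mem_slhomog => /eqP hu /eqP hv; apply: val_inj.
by rewrite /= slbrE (scomm_skew hu hv) -slbrE.
Qed.

Lemma slbr_jacobi d e g (u v w : slspace) :
  u \in homog slspace d -> v \in homog slspace e -> w \in homog slspace g ->
  slbr u (slbr v w) = slbr (slbr u v) w + (-1) ^+ (d * e) *: slbr v (slbr u w).
Proof.
rewrite /= !mem_slhomog => /eqP hu /eqP hv /eqP hw; apply: val_inj.
by rewrite /= !slbrE (scomm_jacobi hu hv hw) -!slbrE.
Qed.

(* A(m, n) = sl(m + 1, n + 1). *)
Definition slA : lieSuperalgebra k :=
  LieSuperalgebra slbr_linearl slbr_linearr slbr_homog slbr_skew slbr_jacobi.

End SpecialLinear.

(* Main.v *)
Require Import Defs.
From HB Require Import structures.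
From mathcomp Require Import all_boot all_order all_algebra.
From mathcomp Require Import zify ring lra.
From Stdlib Require Import Classical.

Set Implicit Arguments.
Unset Strict Implicit.
Unset Printing Implicit Defensive.

Import Order.TTheory GRing.Theory Num.Theory.
Local Open Scope ring_scope.

(** Put p = m + 1, q = n + 1, and let F be a simple Filippov superalgebra of
    type sl(p, q). Since p != q, the identity matrix is not in sl(p, q);
    letting it act by 0 turns F into a module over gl(p, q), on which the
    matrix units E i j act by superderivations of the bracket, without proper
    graded submodules, and such that all the operators ad_k(y) are
    combinations of the E i j ([mxaction], [has_type_mxaction]).

    Weights. If the entries of a bracket are weight vectors, the operator ad_k
    made of all of them but the k-th is a weight vector in the adjoint module;
    so, if the bracket is not 0, the weights of these N - 1 entries add up to
    a root or to 0 ([fbr_weight]). For a set S of indices, let x_S be the sum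
    of the coordinates in S of a weight. If the largest and the smallest value
    of x_S differed by more than 2, then leaving out in turn an entry where
    x_S is largest and an entry where it is smallest would show that no
    nonzero bracket has both kinds of entries, and irreducibility would make
    the bracket vanish altogether ([width]). Conversely each root vector is a
    combination of operators ad(y), which shows that the weights are multiples
    of 1 / (N - 1) and that x_S takes values of both signs ([root_tuple],
    [sign_pos]).

    The Casimir operator. It acts on F by a scalar c. Acting on the value of a
    bracket, it can be computed slot by slot, and each slot contributes c
    minus p - q, half the Casimir scalar of the adjoint module, because the
    bracket is an inner derivation in this slot too. Hence c = N (c - (p -
    q)), that is, c = N / (N - 1) * (p - q) ([casimir_fbr]). When p > q this
    lies strictly above p - q and is at most 3 / 2 * (p - q), as N >= 3.

    The contradiction. Let p > q, after exchanging the blocks if necessary,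
    and let (a_1, ..., a_p | b_1, ..., b_q) be the highest weight for the
    Borel subalgebra that puts the larger block first ([highest_facts]). By
    the width bound the product of three odd lowering operators E f i, E f j,
    E f k is 0, so that (a_i + b_f + 2) (a_j + b_f + 1) (a_k + b_f) = 0 for i
    < j < k; likewise cubes of even root vectors are 0. Together with the sign
    conditions this leaves, for p >= 3, only the highest weights of the
    adjoint module, of the dual of the natural module and, if q = 1, of a
    summand of the tensor square of the latter. Their Casimir scalars are 2 (p
    - q), p - q - 1 / (p - q) and a number above 2 (p - 1), none of which is
    admissible ([no_weight_many]). For (p, q) = (2, 1) two one-parameter
    families are left, and the admissible interval excludes them as well
    ([no_weight_two]). *)

(** * Linear algebra *)

(** The span of a predicate that need not be decidable; excluded middle is
    used to enlarge a finite family until it is maximal. *)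
Lemma span_of_pred (K : fieldType) (V : vectType K) (P : V -> Prop) :
  exists s : seq V, (forall v, v \in s -> P v) /\ forall v, P v ->
      v \in <<s>>%VS.
Proof.
suff H n (s : seq V) : (\dim {:V} - \dim <<s>> < n)%N -> (forall v, v \in s ->
    P v) ->
    exists s : seq V, (forall v, v \in s -> P v) /\ forall v, P v ->
        v \in <<s>>%VS.
  by apply: (H _ [::]) => //; apply: ltnSn.
elim: n s => [//|n IHn] s lt_n sP.
case: (classic (forall v, P v -> v \in <<s>>%VS)) => [sV|]; first by exists s.
move=> /not_all_ex_not[v nv]; have [Pv /negP vs] := imply_to_and _ _ nv.
apply: (IHn (v :: s)); last first.
  by move=> u; rewrite inE => /orP[/eqP->|/sP].
have lt_s : (\dim <<s>> < \dim <<v :: s>>)%N.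
  have le_s : (<<s>> <= <<v :: s>>)%VS by rewrite span_cons addvSr.
  rewrite (ltn_leqif (dimv_leqif_sup le_s)).
  by apply: contra vs => /subvP; apply; rewrite memv_span ?mem_head.
rewrite -ltnS; apply: leq_trans lt_n; rewrite ltnS.
by rewrite ltn_sub2l // (leq_trans lt_s) // dimvS ?subvf.
Qed.

Lemma span_linear (K : fieldType) (V W : vectType K) (f : {linear V -> W})
    (s : seq V) (U : {vspace W}) :
  (forall v, v \in s -> f v \in U) -> forall v, v \in <<s>>%VS -> f v \in U.
Proof.
move=> sU v vs; have : v \in (linfun f @^-1: U)%VS.
  by move: v vs; apply/subvP/span_subvP => u /sU; rewrite -memv_preim lfunE.
by rewrite -memv_preim lfunE.
Qed.

Definition joint_eigen (K : fieldType) (V : vectType K) (I : finType)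
    (T : I -> 'End(V)) (x : {ffun I -> K}) (v : V) := forall i, T i v = x i *:
        v.

(** The operator R is a product of factors T i - y i, one for each y in L,
    with i chosen such that x i != y i; it acts by a scalar on every joint
    eigenvector, so the T i need not commute. *)
Lemma joint_eigen_separate (K : fieldType) (V : vectType K) (I : finType)
    (T : I -> 'End(V)) (x : {ffun I -> K}) (L : seq {ffun I -> K}) :
  x \notin L -> exists (R : 'End(V)) (r : {ffun I -> K} -> K),
    [/\ forall y v, joint_eigen T y v -> R v = r y *: v, r x != 0
      & forall y, y \in L -> r y = 0].
Proof.
elim: L => [_|y L IHL].
  exists \1%VF, (fun=> 1); split=> // [y v _|]; last exact: oner_neq0.
  by rewrite id_lfunE scale1r.
rewrite inE negb_or => /andP[ne_xy /IHL[R [r [Rr rx rL]]]].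
have /existsP[i ne_i] : [exists i, x i != y i].
  apply: contraNT ne_xy => /existsPn xy; apply/eqP/ffunP => i.
  by have := xy i; rewrite negbK => /eqP.
exists ((T i - y i *: \1) \o R)%VF, (fun z : {ffun I -> K} => (z i - y i) * r
    z); split.
- move=> z v vz; rewrite comp_lfunE (Rr _ _ vz) linearZ /= add_lfunE opp_lfunE.
  by rewrite scale_lfunE id_lfunE vz -scalerBl scalerA mulrC.
- by rewrite mulf_neq0 // subr_eq0.
- move=> z; rewrite inE => /orP[/eqP->|/rL->]; last by rewrite mulr0.
  by rewrite subrr mul0r.
Qed.

(** All the weights of a module spanned by weight vectors occur in the
    spanning family. *)
Lemma joint_eigen_span (K : fieldType) (V : vectType K) (I : finType)
    (T : I -> 'End(V)) (x : {ffun I -> K}) (v : V) (s : seq V)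
    (w : V -> {ffun I -> K}) :
  (forall u, u \in s -> joint_eigen T (w u) u) -> joint_eigen T x v -> v != 0 ->
  v \in <<s>>%VS -> exists u, [/\ u \in s, u != 0 & w u = x].
Proof.
move=> sw vx v0 vs.
case: (boolP (x \in [seq w u | u <- s & u != 0])) => [/mapP[u]|].
  by rewrite mem_filter => /andP[u0 us] ->; exists u.
case/(@joint_eigen_separate _ _ _ T) => R [r [Rr rx rL]].
have : R v = 0.
  have /(span_linear (f := R) (U := 0%VS)) : forall u, u \in s -> R u \in 0%VS.
    move=> u us; rewrite memv0 (Rr _ _ (sw _ us)).
    have [->|u0] := eqVneq u 0; first by rewrite scaler0.
    by rewrite rL ?scale0r //; apply: map_f; rewrite mem_filter u0.
  by move/(_ v vs); rewrite memv0 => /eqP.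
by rewrite (Rr _ _ vx) => /eqP; rewrite scaler_eq0 (negPf rx) (negPf v0).
Qed.

(** The vector w is a polynomial in f applied to v, and so has every property
    of v that is expressed by an f-stable subspace; this is how joint
    eigenvectors of commuting operators are found one operator at a time. *)
Lemma eigenvector_in (K : closedFieldType) (V : vectType K) (f : 'End(V))
    (v : V) :
  v != 0 -> exists (c : K) (w : V),
    [/\ w != 0, f w = c *: w & forall U : {vspace V},
      (forall u, u \in U -> f u \in U) -> v \in U -> w \in U].
Proof.
move=> v0.
pose ev (q : {poly K}) := \sum_(i < size q) q`_i *: iter i f v.
have evE n (q : {poly K}) : (size q <= n)%N -> ev q = \sum_(i < n) q`_i *:
    iter i f v.
  move=> le_n; rewrite /ev (big_ord_widen _ (fun i => q`_i *: iter i f v) le_n).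
  rewrite big_mkcond; apply: eq_bigr => i _ /=.
  by case: ltnP => // /(nth_default 0) ->; rewrite scale0r.
(* The iterates of v under f are linearly dependent. *)
have [q q0 evq] : exists2 q, q != 0 & ev q = 0.
  have : ~~ free [seq iter (nat_of_ord i) f v | i <- enum 'I_(\dim {:V}).+1].
    rewrite /free neq_ltn; apply/orP; left.
    rewrite (leq_ltn_trans (dimvS (subvf _))) //.
    by rewrite size_map size_enum_ord.
  set X := map _ _ => nX.
  have sX : size X == (\dim {:V}).+1 by rewrite size_map size_enum_ord.
  have nf : ~~ free (Tuple sX) by [].
  case: (classic (exists k : 'I_(\dim {:V}).+1 -> K,
     \sum_(i < (\dim {:V}).+1) k i *: (Tuple sX)`_i = 0 /\ exists i, k i != 0)).
    case=> k [k0 [i ki]]; exists (\poly_(j < (\dim {:V}).+1) k (inord j)).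
      apply: contraNneq ki => /(congr1 (fun q : {poly K} => q`_i)).
      by rewrite coef_poly ltn_ord inord_val coef0 => /eqP.
    rewrite (@evE (\dim {:V}).+1) ?size_poly // -[RHS]k0; apply: eq_bigr => j _.
    rewrite coef_poly ltn_ord inord_val /= (nth_map ord0) ?size_enum_ord //.
    by rewrite nth_enum_ord.
  move=> nk; case/negP: nf; apply/freeP => k k0 i; apply/eqP/negPn/negP => ki.
  by apply: nk; exists k; split=> //; exists i.
have evB (q1 : {poly K}) c : ev (('X - c%:P) * q1) = f (ev q1) - c *: ev q1.
  rewrite mulrBl (@evE (size q1).+1); last first.
    rewrite (leq_trans (size_polyD _ _)) // geq_max size_polyN.
    rewrite mul_polyC (leq_trans (size_scale_leq _ _)) // andbT.
    by rewrite (leq_trans (size_polyMleq _ _)) // size_polyX.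
  rewrite (eq_bigr (fun i : 'I__ => ('X * q1)`_i *: iter i f v
                         - c *: (q1`_i *: iter i f v))); last first.
    by move=> i _; rewrite coefB mul_polyC coefZ scalerBl scalerA.
  rewrite sumrB -scaler_sumr -(@evE _ q1) //; congr (_ - _).
  rewrite big_ord_recl /= coefXM /= scale0r add0r raddf_sum.
  by apply: eq_bigr => i _; rewrite coefXM [RHS]linearZ.
have [rs q_rs] := closed_field_poly_normal q.
have evZ a (q1 : {poly K}) : ev (a *: q1) = a *: ev q1.
  rewrite (@evE (size q1)) ?size_scale_leq // scaler_sumr.
  by apply: eq_bigr => i _; rewrite coefZ scalerA.
move: evq; rewrite q_rs evZ => /eqP.
rewrite scaler_eq0 lead_coef_eq0 (negPf q0) => /eqP evrs {q q0 q_rs evZ}.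
have ev1 : ev 1 != 0 by rewrite (@evE 1) ?size_poly1 // big_ord1 coef1 scale1r.
(* Removing the linear factors of q one by one, w is the last nonzero value of
   ev and c is the root that turns it into 0. *)
elim: rs evrs => [|c rs IH]; first by rewrite big_nil => e1; rewrite e1 eqxx in
    ev1.
rewrite big_cons evB => /eqP; rewrite subr_eq0 => /eqP evc.
have [/IH //|nz] := eqVneq (ev (\prod_(z <- rs) ('X - z%:P))) 0.
exists c, (ev (\prod_(z <- rs) ('X - z%:P))); split=> // U Uf vU.
apply: memv_suml => i _; apply: memvZ.
by elim: (nat_of_ord i) => [|j IHj] //=; apply: Uf.
Qed.

Lemma upd_upd (T : Type) n (y : {ffun 'I_n -> T}) j u v :
  upd (upd y j u) j v = upd y j v.
Proof. by apply/ffunP => l; rewrite !ffunE; case: eqP. Qed.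

Lemma upd_id (T : Type) n (y : {ffun 'I_n -> T}) j : upd y j (y j) = y.
Proof. by apply/ffunP => l; rewrite !ffunE; case: eqP => [->|]. Qed.

Lemma updC (T : Type) n (y : {ffun 'I_n -> T}) i j u v : i != j ->
  upd (upd y i u) j v = upd (upd y j v) i u.
Proof.
move=> ij; apply/ffunP => l; rewrite !ffunE.
by case: (eqVneq l j) => [->|//]; rewrite eq_sym (negPf ij).
Qed.

Lemma upd_same (T : Type) n (y : {ffun 'I_n -> T}) j u : upd y j u j = u.
Proof. by rewrite ffunE eqxx. Qed.

(** Multilinear maps are determined by their values on spanning families, here
    in the form of membership of the values in U. *)
Lemma multilin_span (K : fieldType) (V W : vectType K) n
    (Phi : {ffun 'I_n -> V} -> W) (s : 'I_n -> seq V) (U : {vspace W}) :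
  (forall y j a u v, Phi (upd y j (a *: u + v)) =
                     a *: Phi (upd y j u) + Phi (upd y j v)) ->
  (forall y : {ffun 'I_n -> V}, (forall j, y j \in s j) -> Phi y \in U) ->
  forall y : {ffun 'I_n -> V}, (forall j, y j \in <<s j>>%VS) -> Phi y \in U.
Proof.
move=> lin sU y ys.
suff H m : (m <= n)%N -> forall y : {ffun 'I_n -> V},
    (forall j : 'I_n, if (j < m)%N then y j \in <<s j>>%VS else y j \in s j) ->
    Phi y \in U.
  by apply: (H n) => // j; rewrite ltn_ord.
elim: m => [_ {}y {}ys|m IHm lt_mn {}y {}ys]; first by apply: sU => j; apply:
    (ys j).
pose j0 := Ordinal lt_mn.
pose f v := Phi (upd y j0 v).
have flin : linear f by move=> a u v; apply: lin.
pose fM := GRing.isLinear.Build _ _ _ _ f flin.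
pose fL : {linear V -> W} := HB.pack f fM.
have fs v : v \in s j0 -> fL v \in U.
  move=> vs; apply: IHm; first exact: ltnW.
  move=> j; rewrite ffunE; case: eqP => [->|jj0]; first by rewrite ltnn.
  have := ys j; rewrite ltnS leq_eqVlt; case: eqP => //= jm.
  by case: jj0; apply: val_inj.
have := span_linear fs; move/(_ (y j0)); rewrite /= /f upd_id; apply.
by have := ys j0; rewrite ltnSn.
Qed.

(** * Parity and inner derivations *)

Section Parity.
Variables (K : fieldType) (V : superspace K).

Lemma hproj_homog d (v : V) : hproj V d v \in homog V d.
Proof. exact: memv_pi. Qed.

Lemma hproj_sum (v : V) : hproj V false v + hproj V true v = v.
Proof.
by apply: (daddv_pi_add (homog_capN V false)); rewrite homog_addN memvf.
Qed.

Definition parfun (v : V) : V := hproj V false v - hproj V true v.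
Lemma parfun_is_linear : linear parfun.
Proof.
by move=> a u v; rewrite /parfun !linearP /= addrACA -scalerDr.
Qed.
HB.instance Definition _ := GRing.isLinear.Build K V V _ parfun
    parfun_is_linear.
Definition parity_op : 'End(V) := linfun parfun.

Lemma parity_opE d (v : V) : v \in homog V d -> parity_op v = (-1) ^+ d *: v.
Proof.
rewrite lfunE /= /parfun; case: d => vd; rewrite (hproj_id vd) (hproj_id0 vd).
  by rewrite sub0r scaleN1r.
by rewrite subr0 scale1r.
Qed.

(** Conjugation by the parity operator multiplies a homogeneous f by the sign
    that it picks up when moved past an element of parity m. Unlike that sign
    it is defined for all f and is linear in f. *)
Definition twist (m : bool) (f : 'End(V)) : 'End(V) :=
  if m then (parity_op \o f \o parity_op)%VF else f.

Lemma twist_is_linear m : linear (twist m).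
Proof.
move=> a f g; case: m => //=; apply/lfunP => v.
by rewrite !(comp_lfunE, add_lfunE, scale_lfunE) linearP.
Qed.
HB.instance Definition _ m :=
  GRing.isLinear.Build K 'End(V) 'End(V) _ (twist m) (twist_is_linear m).

Lemma twistE m d f : end_homog d f -> twist m f = (-1) ^+ (m && d) *: f.
Proof.
case: m => /= fd; last by rewrite scale1r.
apply/lfunP => v; rewrite scale_lfunE -[v]hproj_sum !linearD /=.
have H e : (parity_op \o f \o parity_op)%VF (hproj V e v) = (-1) ^+ d *:
    f (hproj V e v).
  have vh := hproj_homog e v.
  rewrite !comp_lfunE (parity_opE vh) !linearZ /= (parity_opE (fd _ _ vh))
      scalerA.
  by rewrite signr_addb mulrCA -expr2 sqrr_sign mulr1.
by rewrite !H.
Qed.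

End Parity.

Arguments twist {K V} m f.

Lemma sgr_sum (R : pzRingType) I (r : seq I) (P : pred I) (p : I -> bool) :
  (-1) ^+ (\sum_(i <- r | P i) p i) = (-1) ^+ (\big[addb/false]_(i <- r | P i) p
      i) :> R.
Proof.
elim/big_rec2: _ => // i y1 y2 _ IH.
by rewrite exprD IH signr_addb.
Qed.

Lemma sgr_mul (R : pzRingType) (b : bool) (n : nat) (c : bool) :
  (-1) ^+ n = (-1) ^+ c :> R -> (-1) ^+ (b * n) = (-1) ^+ (b && c) :> R.
Proof. by case: b => /=; rewrite ?mul1n ?mul0n. Qed.

Section Bracket.
Variables (K : fieldType) (N : nat) (F : filippovSuperalgebra K N).

Definition slot (x : {ffun 'I_N -> F}) (k : 'I_N) (v : F) : F :=
    fbr (upd x k v).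
Lemma slot_is_linear x k : linear (slot x k).
Proof. by move=> a u v; apply: fbr_linear. Qed.
HB.instance Definition _ x k :=
  GRing.isLinear.Build K F F _ (slot x k) (slot_is_linear x k).

Definition ins_parity (k : 'I_N) (d : bool) (p : 'I_N.-1 -> bool) (l : 'I_N) :
    bool :=
  if unlift k l is Some l' then p l' else d.

Lemma homogs_ins p (y : {ffun 'I_N.-1 -> F}) k d v : homogs p y ->
  v \in homog F d -> homogs (ins_parity k d p) (ins k v y).
Proof. by move=> py vd l; rewrite ffunE /ins_parity; case: unliftP. Qed.

Definition del (T : Type) (k : 'I_N) (x : 'I_N -> T) (l : 'I_N.-1) :=
    x (lift k l).

Lemma ins_del (x : {ffun 'I_N -> F}) k v : ins k v [ffun l => del k x l] =
    upd x k v.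
Proof.
apply/ffunP => l; rewrite !ffunE; case: unliftP => [j ->|->]; last by rewrite
    eqxx.
by rewrite ffunE eq_sym (negPf (neq_lift _ _)).
Qed.

Lemma lift_ge (k : 'I_N) (l : 'I_N.-1) : (k < lift k l)%N = (k <= l)%N.
Proof.
rewrite /= /bump; case: (leqP k l) => h; first by rewrite add1n ltnS h.
by rewrite add0n ltnNge (ltnW h).
Qed.

(** By skew-supersymmetry the operators ad_i agree up to sign: the sign in the
    definition of ad_i is the one that makes the parities of the arguments
    disappear here. *)
Lemma adS (i j : 'I_N) p (y : {ffun 'I_N.-1 -> F}) : j = i.+1 :> nat ->
  homogs p y -> ad j p y = - ad i p y.
Proof.
move=> ji py; apply/lfunP => v; rewrite opp_lfunE -[v]hproj_sum !linearD /=.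
suff H d u : u \in homog F d -> ad j p y u = - ad i p y u.
  by rewrite !(H _ _ (hproj_homog _ v)).
move=> ud; rewrite !(adE _ _ _ ud).
have iN : (i < N.-1)%N by rewrite -ltnS (leq_trans _ (leqSpred N)) // -ji
    ltn_ord.
pose l0 := Ordinal iN.
have li : lift j l0 = i.
  by apply: val_inj; rewrite /= /bump ji ltnn.
have lj : lift i l0 = j.
  by apply: val_inj; rewrite /= /bump leqnn ji.
rewrite (fbr_skew (homogs_ins j py ud) ji).
have -> : ins_parity j d p i = p l0 by rewrite /ins_parity -{1}li liftK.
have -> : ins_parity j d p j = d by rewrite /ins_parity unlift_none.
have -> : upd (upd (ins j u y) i (ins j u y j)) j (ins j u y i) = ins i u y.
  apply/ffunP => l; rewrite !ffunE.
  have [->|lnj] := eqVneq l j; first by rewrite -{1}li -lj !liftK.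
  have [->|lni] := eqVneq l i; first by rewrite !unlift_none.
  case: (unliftP j l) => [a la|lj']; last by rewrite lj' eqxx in lnj.
  case: (unliftP i l) => [b lb|li']; last by rewrite li' eqxx in lni.
  congr (y _); apply: val_inj; move: lni lnj; rewrite -!val_eqE /=.
  have := congr1 val la; have := congr1 val lb; rewrite /= /bump ji.
  by case: (leqP i b); case: (leqP i.+1 a); lia.
rewrite scalerN scalerA -exprD; congr (- (_ *: _)).
rewrite [in RHS](bigD1 l0) /=; last by [].
rewrite mulnDr [(d * p l0)%N]mulnC addnC; congr ((-1) ^+ (_ + _ * _)).
apply: eq_bigl => l; rewrite ji ltn_neqAle andbC; congr (_ && _).
by rewrite eq_sym.
Qed.

Lemma ad_first (i0 i : 'I_N) p (y : {ffun 'I_N.-1 -> F}) : i0 = 0%N :> nat ->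
  homogs p y -> ad i p y = (-1) ^+ i *: ad i0 p y.
Proof.
move=> i00 py; case: i => i lt_i /=; elim: i lt_i => [|i IHi] lt_i.
  by rewrite scale1r; congr (ad _ _ _); apply: val_inj; rewrite /= i00.
rewrite (@adS (Ordinal (ltnW lt_i)) (Ordinal lt_i)) // IHi exprS.
by rewrite -scalerA scaleN1r.
Qed.

Lemma ad_homog i p (y : {ffun 'I_N.-1 -> F}) : homogs p y ->
  end_homog (\big[addb/false]_j p j) (ad i p y).
Proof.
move=> py d v vd; rewrite (adE _ _ _ vd); apply: memvZ.
have := fbr_homog (homogs_ins i py vd).
rewrite (bigD1 i) //= {1}/ins_parity unlift_none addbC.
set X := \big[_/_]_(_ | _) _; suff -> : X = \big[addb/false]_j p j by [].
rewrite /X (reindex_omap (lift i) (unlift i)); last first.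
  by move=> j; case: unliftP => [l -> //|->]; rewrite eqxx.
apply: eq_big => [l|l _]; first by rewrite liftK eqxx eq_sym neq_lift.
by rewrite /ins_parity liftK.
Qed.

(** With the twist the rule makes sense for operators of mixed parity and
    defines a linear subspace, which therefore contains the span of its
    homogeneous elements. *)
Definition superder (f : 'End(F)) : Prop :=
  forall p (x : {ffun 'I_N -> F}), homogs p x ->
    f (fbr x) = \sum_k slot x k (twist (\big[addb/false]_(l < N | (l < k)%N) p
        l) f (x k)).

(** For the first slot this is the Filippov identity; the other slots follow
    from [ad_first]. *)
Lemma ad_superder i p (y : {ffun 'I_N.-1 -> F}) : homogs p y ->
  superder (ad i p y).
Proof.
move=> py.
have i0N : (0 < N)%N by apply: leq_ltn_trans (ltn_ord i).
suff H : superder (ad (Ordinal i0N) p y).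
  move=> q x qx; rewrite (@ad_first (Ordinal i0N)) // scale_lfunE (H _ _ qx).
  rewrite scaler_sumr; apply: eq_bigr => k _.
  by rewrite !linearZ /= scale_lfunE linearZ.
set i0 := Ordinal i0N; move=> q x qx.
rewrite (adE _ _ _ (fbr_homog qx)) (fbr_filippov _ qx py) // scaler_sumr.
apply: eq_bigr => k _.
rewrite (twistE _ (ad_homog i0 py)) scale_lfunE (adE _ _ _ (qx k)).
rewrite !linearZ /= /slot !scalerA; congr (_ *: _).
rewrite mulrC; set P := \big[addb/false]_j p j.
have sP : (-1) ^+ (\sum_j p j) = (-1) ^+ P :> K by rewrite sgr_sum.
have -> : (\sum_(j < N.-1 | (i0 <= j)%N) p j = \sum_j p j)%N by apply: eq_bigl.
rewrite !(sgr_mul _ sP).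
have -> : (-1) ^+ ((\sum_j p j) * \sum_(j < N | (k < j)%N) q j) =
   (-1) ^+ (P && \big[addb/false]_(j < N | (k < j)%N) q j) :> K.
  rewrite exprM sP -exprM; apply: sgr_mul; exact: sgr_sum.
rewrite -!signr_addb; congr ((-1) ^+ (nat_of_bool _)).
have -> : \big[addb/false]_i q i = \big[addb/false]_(l < N | (l < k)%N) q l
    (+) (q k (+) \big[addb/false]_(l < N | (k < l)%N) q l).
  rewrite (bigID (fun l : 'I_N => (l < k)%N)) /=; congr (_ (+) _).
  rewrite (bigD1 k) /=; last by rewrite ltnn.
  congr (_ (+) _); apply: eq_bigl => l; rewrite -leqNgt ltn_neqAle andbC.
  by rewrite eq_sym.
case: P {sP} => /=; rewrite ?andbF //= ?andbT.
by case: (q k); case: (\big[_/_]_(_ < _ | _) _); case: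
    (\big[_/_]_(_ < _ | _) _).
Qed.

Lemma inder_superder (f : 'End(F)) : Inder f -> superder f.
Proof.
case=> s [sad fs] p x px.
pose D (g : 'End(F)) : F := g (fbr x) - 
  \sum_k slot x k (twist (\big[addb/false]_(l < N | (l < k)%N) p l) g (x k)).
have Dlin : linear D.
  move=> a g h; rewrite /D add_lfunE scale_lfunE scalerBr addrACA -opprD.
  congr (_ - _); rewrite scaler_sumr -big_split; apply: eq_bigr => k _ /=.
  by rewrite linearP add_lfunE scale_lfunE linearP.
pose DM := GRing.isLinear.Build _ _ _ _ D Dlin.
pose DL : {linear 'End(F) -> F} := HB.pack D DM.
have /(span_linear (f := DL)) : forall g, g \in s ->
    DL g \in (0%VS : {vspace F}).
  move=> g /sad[i [q [y [qy ->]]]].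
  by rewrite memv0 /= /D subr_eq0; apply/eqP/ad_superder.
by move/(_ _ fs); rewrite memv0 /= /D subr_eq0 => /eqP.
Qed.

End Bracket.

(** * The action of the matrix units *)

Lemma seq_choice (A : eqType) (B : Type) (b0 : B) (Q : A -> B -> Prop)
    (s : seq A) :
  (forall v, v \in s -> exists x, Q v x) -> exists w, forall v, v \in s ->
      Q v (w v).
Proof.
elim: s => [|u s IHs] sQ; first by exists (fun=> b0).
have [x Qx] := sQ u (mem_head _ _).
have [|w wQ] := IHs; first by move=> v vs; apply: sQ; rewrite inE vs orbT.
exists (fun v => if v == u then x else w v) => v.
by rewrite inE; case: eqP => [->|_ /wQ].
Qed.

Section Homog.
Variables (K : fieldType) (V : superspace K).

Lemma homog_span (s : seq V) d v :
  (forall u, u \in s -> exists e, u \in homog V e) ->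
  v \in <<s>>%VS -> v \in homog V d -> v \in <<[seq u <- s | u \in homog V
      d]>>%VS.
Proof.
move=> sh vs vd; rewrite -(hproj_id vd).
move: v vs {vd}; apply: (span_linear (f := hproj V d)) => u us.
have [ud|nud] := boolP (u \in homog V d).
  by rewrite /= hproj_id // memv_span // mem_filter ud.
have [e ue] := sh _ us; rewrite /=; suff -> : hproj V d u = 0 by apply: mem0v.
have de : d = ~~ e by apply/eqP; case: eqP ue nud; case: d; case: e => // _ ->.
by rewrite de hproj_id0.
Qed.

Definition hbasis : seq V := vbasis (homog V false) ++ vbasis (homog V true).

Lemma hbasis_homog u : u \in hbasis -> exists e, u \in homog V e.
Proof. by rewrite mem_cat => /orP[] /vbasis_mem; [exists false | exists true].
    Qed.

Lemma hbasis_span : <<hbasis>>%VS = fullv.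
Proof.
by rewrite span_cat (span_basis (vbasisP _)) (span_basis (vbasisP _)) homog_add.
Qed.

End Homog.

Section Ad.
Variables (K : fieldType) (N : nat) (F : filippovSuperalgebra K N).

Definition delf (k : 'I_N) (y : {ffun 'I_N -> F}) : {ffun 'I_N.-1 -> F} :=
  [ffun l => del k y l].

Lemma homogs_del k p (y : {ffun 'I_N -> F}) : homogs p y -> homogs (del k p)
    (delf k y).
Proof. by move=> py l; rewrite ffunE; apply: py. Qed.

Lemma big_del (op : Monoid.com_law false) k (P : pred 'I_N) (p : 'I_N -> bool) :
  \big[op/false]_(l < N.-1 | P (lift k l)) del k p l
  = \big[op/false]_(l < N | (l != k) && P l) p l.
Proof.
rewrite [RHS](reindex_omap (lift k) (unlift k)); last first.
  by move=> j /andP[]; case: unliftP => [l -> //|->]; rewrite eqxx.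
by apply: eq_bigl => l; rewrite liftK eqxx eq_sym neq_lift /= andbT.
Qed.

Lemma ad_slot k p (y : {ffun 'I_N -> F}) d v : homogs p y -> v \in homog F d ->
  slot y k v = (-1) ^+ (d && \big[addb/false]_(l < N | (k < l)%N) p l)
                 *: ad k (del k p) (delf k y) v.
Proof.
move=> py vd; rewrite (adE _ _ _ vd) scalerA /slot ins_del.
set b := \big[_/_]_(_ < _ | _) _.
suff -> : (-1) ^+ (d * (\sum_(j < N.-1 | (k <= j)%N) del k p j)) = (-1) ^+
    (d && b) :> K.
  by rewrite -expr2 sqrr_sign scale1r.
apply: sgr_mul; rewrite sgr_sum; congr ((-1) ^+ (nat_of_bool _)).
rewrite (eq_bigl (fun j => (k < lift k j)%N)) => [|j]; last by rewrite lift_ge.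
rewrite (big_del _ k (fun l => (k < l)%N)); apply: eq_bigl => l.
by case: eqP => //= ->; rewrite ltnn.
Qed.

End Ad.

Section Action.
Variables (K : fieldType) (N : nat) (F : filippovSuperalgebra K N).
Variables (T : finType) (s : T -> bool) (E : T -> T -> 'End(F)).

(** An action of gl on F, with the index i of parity s i: the supercommutation
    relations of the matrix units, the identity matrix acting by 0, and the
    identification of the inner derivations with the image. *)
Record mxaction : Prop := MxAction {
  act_homog : forall i j, end_homog (s i (+) s j) (E i j);
  act_comm : forall i j a b v, E i j (E a b v) =
     (-1) ^+ ((s i (+) s j) && (s a (+) s b))
       *: (E a b (E i j v) - (i == b)%:R *: E a j v) + (j == a)%:R *: E i b v;
  act_trace : forall v, \sum_i E i i v = 0;
  act_inder : forall i j, Inder (E i j);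
  act_ad : forall f : 'End(F), is_ad f -> exists c : T -> T -> K,
     f = \sum_i \sum_j c i j *: E i j;
  act_inj : forall i j, i != j -> E i j != 0 }.

Hypothesis act : mxaction.

Lemma E_deriv i j p (x : {ffun 'I_N -> F}) : homogs p x ->
  E i j (fbr x) = \sum_(k < N) (-1) ^+ (\big[addb/false]_(l < N | (l < k)%N) p l
                       && (s i (+) s j)) *: slot x k (E i j (x k)).
Proof.
move=> px; rewrite (inder_superder (act_inder act i j) px).
apply: eq_bigr => k _; rewrite (twistE _ (act_homog act i j)).
by rewrite scale_lfunE linearZ.
Qed.

Lemma ad_in_span (f : 'End(F)) (U : {vspace F}) v : is_ad f ->
  (forall i j, E i j v \in U) -> f v \in U.
Proof.
move=> /(act_ad act)[c ->] EU; rewrite sum_lfunE memv_suml // => i _.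
rewrite sum_lfunE memv_suml // => j _; rewrite scale_lfunE; exact: memvZ.
Qed.

(** Irreducibility, for submodules given as spans of arbitrary families of
    homogeneous vectors: a graded subspace stable under the E i j is an ideal. *)
Lemma irr_span (P : F -> Prop) : fsimple F ->
  (forall v, P v -> exists d, v \in homog F d) ->
  (forall v i j, P v -> forall U : {vspace F}, (forall u, P u -> u \in U) ->
      E i j v \in U) ->
  (exists2 v, P v & v != 0) ->
  exists S : seq F, (forall v, v \in S -> P v) /\ <<S>>%VS = fullv.
Proof.
move=> [_ simF] Ph PE [v0 Pv0 v0n].
have [S [SP PS]] := span_of_pred P.
exists S; split=> //; set U := <<S>>%VS.
have Sh d u : u \in U -> u \in homog F d -> u \in <<[seq u <- S | u \in homog F
    d]>>%VS.
  by move=> uU; apply: homog_span => // w /SP/Ph.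
suff /simF[U0|//] : fideal U.
  by have := PS _ Pv0; rewrite -/U U0 memv0 (negPf v0n).
split.
  apply/eqP; rewrite eqEsubv subv_add !capvSl /= andbT; apply/span_subvP =>
      u uS.
  have uU : u \in U by apply: memv_span.
  have [[] ud] := Ph _ (SP _ uS).
    by rewrite -[u]add0r memv_add ?mem0v // memv_cap uU.
  by rewrite -[u]addr0 memv_add ?mem0v // memv_cap uU.
move=> i0 x i00 xU; rewrite -[x](upd_id _ i0).
move: (x i0) xU; apply: (span_linear (f := slot x i0)) => u uS.
pose L (l : 'I_N) := if l == i0 then [:: u] else hbasis F.
have := @multilin_span K F F N (@fbr _ _ F) L U; move/(_ (@fbr_linear _ _ F)).
apply; last first.
  move=> l; rewrite ffunE /L; case: eqP => _; first by rewrite memv_span1.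
  by rewrite hbasis_span memvf.
move=> y yL.
have /(seq_choice false)[w wh] : forall v, v \in u :: hbasis F -> exists d,
    v \in homog F d.
  by move=> v; rewrite inE => /orP[/eqP->|/hbasis_homog//]; apply/Ph/SP.
have yu : y i0 = u by have := yL i0; rewrite /L eqxx inE => /eqP.
have py : homogs (fun l => w (y l)) y.
  move=> l; apply: wh; have := yL l; rewrite /L inE.
  by case: eqP => [_|_ ->]; rewrite ?inE ?orbT // => ->.
(* The bracket is an inner derivation applied to u, hence a combination of the
   vectors E i j u. *)
rewrite -[y](upd_id _ i0) -/(slot y i0 (y i0)) (ad_slot _ py (py i0)) memvZ //.
apply: ad_in_span; first by exists i0, (del i0 (fun l => w (y l))), (delf i0 y);
  split=> //; apply: homogs_del.
by move=> i j; rewrite yu; apply: PE => //; apply: SP.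
Qed.

End Action.

(** * Weights *)

Section AdOp.
Variables (K : fieldType) (V : vectType K).
Definition comm_fun (g f : 'End(V)) : 'End(V) := ((g \o f) - (f \o g))%VF.
Lemma comm_fun_is_linear g : linear (comm_fun g).
Proof.
move=> a f h; apply/lfunP => v.
rewrite !(add_lfunE, opp_lfunE, comp_lfunE, scale_lfunE) linearP /=.
by rewrite scalerBr opprD addrACA.
Qed.
HB.instance Definition _ g :=
  GRing.isLinear.Build K 'End(V) 'End(V) _ (comm_fun g) (comm_fun_is_linear g).
Definition ad_op (g : 'End(V)) : 'End('End(V)) := linfun (comm_fun g).
Lemma ad_opE g f v : ad_op g f v = g (f v) - f (g v).
Proof. by rewrite lfunE /= add_lfunE opp_lfunE !comp_lfunE. Qed.
End AdOp.

Section Weights.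
Variables (K : fieldType) (N : nat) (F : filippovSuperalgebra K N).
Variables (T : finType) (s : T -> bool) (E : T -> T -> 'End(F)).
Hypothesis act : mxaction s E.

Definition rootw (a b : T) : {ffun T -> int} :=
    [ffun i => (i == a)%:R - (i == b)%:R].

Definition has_weight (x : {ffun T -> K}) (v : F) := joint_eigen (fun i =>
    E i i) x v.

Lemma E_diag l i j v :
  E l l (E i j v) = E i j (E l l v) + ((rootw i j l)%:~R : K) *: E i j v.
Proof.
rewrite (act_comm act) addbb /= scale1r ffunE rmorphB /= !natz scalerBl.
rewrite [in RHS]addrA addrAC; congr (_ - _ + _).
  by case: (eqVneq l j) => [->|]; rewrite ?scale0r.
by case: (eqVneq l i) => [->|]; rewrite ?scale0r.
Qed.

Lemma has_weight_E x i j v : has_weight x v ->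
  has_weight [ffun l => x l + (rootw i j l)%:~R] (E i j v).
Proof. by move=> vx l; rewrite E_diag vx linearZ /= -scalerDl [in RHS]ffunE.
    Qed.

Lemma ad_op_unit l i j : ad_op (E l l) (E i j) = ((rootw i j l)%:~R : K) *:
    E i j.
Proof. by apply/lfunP => v; rewrite ad_opE E_diag addrC addKr scale_lfunE. Qed.

(** As E i i is an even superderivation, its commutator with ad_k(y) replaces
    the entries of y one at a time by multiples of themselves. *)
Lemma ad_weight k p (y : {ffun 'I_N.-1 -> F}) (x : 'I_N.-1 -> {ffun T -> K}) :
  homogs p y -> (forall l, has_weight (x l) (y l)) ->
  joint_eigen (fun i => ad_op (E i i)) [ffun i => \sum_l x l i] (ad k p y).
Proof.
move=> py yx i; apply/lfunP => v; rewrite ffunE ad_opE scale_lfunE.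
suff H d u : u \in homog F d ->
    E i i (ad k p y u) - ad k p y (E i i u) = (\sum_l x l i) *: ad k p y u.
  by rewrite -[v]hproj_sum !linearD /= addrACA !(H _ _ (hproj_homog _ v)).
move=> ud; have Eud : E i i u \in homog F d.
  by have := act_homog act i i ud; rewrite addbb.
rewrite !(adE _ _ _ ud, adE _ _ _ Eud) linearZ /= -scalerBr [in RHS]scalerA.
rewrite [in RHS]mulrC -scalerA; congr (_ *: _).
rewrite (E_deriv act _ _ (homogs_ins k py ud)) addbb.
rewrite (eq_bigr (fun m => slot (ins k u y) m (E i i (ins k u y m))));
    last first.
  by move=> m _; rewrite andbF scale1r.
rewrite (bigD1 k) //= [X in slot _ _ (E _ _ X)]ffunE unlift_none.
rewrite {1}/slot -ins_upd addrAC subrr add0r.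
rewrite (reindex_omap (lift k) (unlift k)); last first.
  by move=> j; case: unliftP => [l -> //|->]; rewrite eqxx.
rewrite scaler_suml; apply: eq_big => [l|l _].
  by rewrite liftK eqxx eq_sym neq_lift.
rewrite ffunE liftK yx linearZ /=; congr (_ *: _).
by rewrite /slot -[in RHS](upd_id (ins k u y) (lift k l)) ffunE liftK.
Qed.

Lemma inder_weight (f : 'End(F)) x : is_ad f -> f != 0 ->
  joint_eigen (fun i => ad_op (E i i)) x f ->
  exists a b, forall i, x i = (rootw a b i)%:~R.
Proof.
move=> /(act_ad act)[c fE] f0 fx.
pose Es := [seq E ij.1 ij.2 | ij <- enum {: T * T}].
have /(seq_choice x)[w wE] : forall g, g \in Es -> exists z : {ffun T -> K},
    joint_eigen (fun i => ad_op (E i i)) z g /\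
    exists a b, forall i, z i = (rootw a b i)%:~R.
  move=> g /mapP[[a b] _ ->]; exists [ffun i => (rootw a b i)%:~R]; split.
    by move=> l; rewrite ad_op_unit [in RHS]ffunE.
  by exists a, b => i; rewrite ffunE.
have fEs : f \in <<Es>>%VS.
  rewrite fE memv_suml // => i _; rewrite memv_suml // => j _; apply: memvZ.
  by apply/memv_span/mapP; exists (i, j); rewrite ?mem_enum.
have [g [gE _ <-]] := joint_eigen_span (fun u us => proj1 (wE u us)) fx f0 fEs.
exact: (proj2 (wE g gE)).
Qed.

(** The operator ad_k built from the other entries is a nonzero weight vector
    in the span of the matrix units. *)
Lemma fbr_weight k p (t : {ffun 'I_N -> F}) (x : 'I_N -> {ffun T -> K}) :
  homogs p t -> (forall l, l != k -> has_weight (x l) (t l)) -> fbr t != 0 ->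
  exists a b, forall i, \sum_(l < N | l != k) x l i = (rootw a b i)%:~R.
Proof.
move=> pt tx t0.
have ht : is_ad (ad k (del k p) (delf k t)).
  by exists k, (del k p), (delf k t); split=> //; apply: homogs_del.
have ad0 : ad k (del k p) (delf k t) != 0.
  apply: contraNneq t0 => ad0.
  rewrite -[t](upd_id _ k) -/(slot t k (t k)) (ad_slot _ pt (pt k)) ad0.
  by rewrite zero_lfunE scaler0.
have [|a [b ab]] := inder_weight ht ad0 (ad_weight k (homogs_del k pt)
   (x := fun l => x (lift k l)) _).
  by move=> l; rewrite ffunE; apply: tx; rewrite eq_sym neq_lift.
exists a, b => i; rewrite -ab ffunE.
rewrite (reindex_omap (lift k) (unlift k)); last first.
  by move=> j; case: unliftP => [l -> //|->]; rewrite eqxx.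
by apply: eq_bigl => l; rewrite liftK eqxx eq_sym neq_lift.
Qed.

Lemma ad_multilinear k p (y : {ffun 'I_N.-1 -> F}) j (a : K) u v :
  ad k p (upd y j (a *: u + v)) = a *: ad k p (upd y j u) + ad k p (upd y j v).
Proof.
have insU (w z : F) : ins k z (upd y j w) = upd (ins k z y) (lift k j) w.
  apply/ffunP => l; rewrite !ffunE; case: (unliftP k l) => [l' ->|->].
    by rewrite (inj_eq lift_inj) ffunE.
  by rewrite (negPf (neq_lift _ _)).
apply/lfunP => z; rewrite add_lfunE scale_lfunE !lfunE /= /ad_fun scaler_sumr.
rewrite -big_split; apply: eq_bigr => d _ /=.
by rewrite !insU fbr_linear scalerDr !scalerA mulrC.
Qed.

(** A root vector is a combination of operators ad_k(y) with y made of
    elements of S; those are weight vectors, so its weight is the weight of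
    one of them. *)
Lemma root_tuple (S : seq F) (w : F -> {ffun T -> K}) a b : a != b ->
  (forall v, v \in S -> exists d, v \in homog F d) -> <<S>>%VS = fullv ->
  (forall v, v \in S -> has_weight (w v) v) ->
  exists y : {ffun 'I_N.-1 -> F}, (forall l, y l \in S /\ y l != 0) /\
    forall i, \sum_l w (y l) i = (rootw a b i)%:~R.
Proof.
move=> ab Sh Sf Sw.
pose P (f : 'End(F)) := exists k p (y : {ffun 'I_N.-1 -> F}),
  [/\ forall l, y l \in S, homogs p y & f = ad k p y].
have [A [AP PA]] := span_of_pred P.
have adA (f : 'End(F)) : is_ad f -> f \in <<A>>%VS.
  case=> k [p [y [py ->]]].
  apply: (@multilin_span K F _ _ (ad k p) (fun l =>
      [seq u <- S | u \in homog F (p l)])).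
  - by move=> z j c u v; apply: ad_multilinear.
  - move=> z zS; apply: PA; exists k, p, z; split=> // l;
      by have := zS l; rewrite mem_filter => /andP[].
  - by move=> l; apply: homog_span => //; rewrite Sf memvf.
have EA : E a b \in <<A>>%VS.
  have [L [Lad]] := act_inder act a b; apply/subvP/span_subvP => f /Lad; exact:
      adA.
have /(seq_choice 0)[wA wAE] : forall f, f \in A -> exists z : {ffun T -> K},
    joint_eigen (fun i => ad_op (E i i)) z f /\
    (f != 0 -> exists y : {ffun 'I_N.-1 -> F}, (forall l, y l \in S /\ y l != 0)
        /\
       forall i, \sum_l w (y l) i = z i).
  move=> f /AP[k [p [y [yS py fE]]]].
  exists [ffun i => \sum_l w (y l) i]; split.
    by rewrite fE; apply: ad_weight => // l; apply: Sw.
  move=> f0; exists y; split=> [l|i]; last by rewrite ffunE.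
  split=> //; apply: contraNneq f0 => yl.
  rewrite fE -[y](upd_id _ l) yl; have := ad_multilinear k p y l (-1) 0 0.
  by rewrite scaler0 add0r scaleN1r addNr => ->.
have Eab : joint_eigen (fun i => ad_op (E i i)) [ffun l => (rootw a b l)%:~R]
    (E a b).
  by move=> l; rewrite ad_op_unit [in RHS]ffunE.
have [f [fA f0 fw]] := joint_eigen_span (fun u us => proj1 (wAE u us)) Eab
    (act_inj act ab) EA.
have [y [yS yw]] := proj2 (wAE f fA) f0.
by exists y; split=> // i; rewrite yw fw ffunE.
Qed.

End Weights.

(** * Integral weights and the width bound *)

Lemma intr_eq0_pchar0 (K : fieldType) (z : int) : [pchar K] =i pred0 ->
  (z%:~R == 0 :> K) = (z == 0).
Proof.
move=> /pcharf0P K0; case: z => n.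
  by change ((n%:R == 0 :> K) = (Posz n == 0)); rewrite K0.
rewrite NegzE rmorphN oppr_eq0.
by change ((n.+1%:R == 0 :> K) = (- Posz n.+1 == 0)); rewrite K0 oppr_eq0.
Qed.

Lemma seq_argmax (A : eqType) (f : A -> int) (s : seq A) :
  s != [::] -> exists2 u, u \in s & forall v, v \in s -> f v <= f u.
Proof.
case: s => // a s _; elim: s a => [|b s IHs] a.
  by exists a; rewrite ?mem_head // => v; rewrite inE => /eqP->.
have [u us um] := IHs b.
have [le_au|lt_ua] := leP (f a) (f u).
  exists u => [|v]; first by rewrite inE us orbT.
  by rewrite inE => /orP[/eqP->|/um].
exists a => [|v]; first exact: mem_head.
rewrite inE => /orP[/eqP-> //|/um h]; exact: le_trans h (ltW lt_ua).
Qed.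

Section IntWeights.
Variables (K : closedFieldType) (N : nat) (F : filippovSuperalgebra K N).
Variables (T : finType) (s : T -> bool) (E : T -> T -> 'End(F)).
Hypothesis act : mxaction s E.
Hypothesis K0 : [pchar K] =i pred0.
Hypothesis simF : fsimple F.
Hypothesis F0 : homog F false <> 0%VS.
Hypothesis N2 : (2 < N)%N.
Variables a0 b0 : T.
Hypothesis ab0 : a0 != b0.

Local Notation M := (N.-1).

Lemma M_neq0 : (M%:R : K) != 0.
Proof. by have := K0 => /pcharf0P ->; case: N N2 => [|[|]]. Qed.

(** A joint eigenvector of the diagonal matrix units, obtained one unit at a
    time. *)
Lemma exists_weight : exists (x : {ffun T -> K}) (d : bool) (v : F),
  [/\ v != 0, v \in homog F d & has_weight E x v].
Proof.
suff [v [v0 vd vE]] : exists v : F, [/\ v != 0, v \in homog F false &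
    forall i, i \in enum T -> exists c, E i i v = c *: v].
  have [c cE] := seq_choice 0 vE.
  exists [ffun i => c i], false, v; split=> // i.
  by rewrite ffunE cE // mem_enum.
elim: (enum T) => [|i L [v [v0 vd vE]]].
  have /eqP := F0; rewrite -subv0 => /subvPn[v vd]; rewrite memv0 => v0.
  by exists v.
have [c [w [w0 wc wU]]] := eigenvector_in (E i i) v0.
exists w; split=> //.
  apply: wU => // u ud; have := act_homog act i i ud; by rewrite addbb.
move=> j; rewrite inE => /orP[/eqP->|/vE[b vb]]; first by exists c.
exists b; apply/eqP; rewrite -subr_eq0.
have : w \in lker (E j j - b *: \1%VF).
  apply: wU => [u|]; rewrite !memv_ker !(add_lfunE, opp_lfunE, scale_lfunE,
      id_lfunE).
    rewrite !subr_eq0 => /eqP ub; rewrite (E_diag act) ub linearZ /=.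
    by rewrite ffunE subrr scale0r addr0.
  by rewrite vb subrr.
by rewrite memv_ker !(add_lfunE, opp_lfunE, scale_lfunE, id_lfunE).
Qed.

(** The weights of F are multiples of 1 / (N - 1); z is the weight multiplied
    by N - 1. *)
Definition has_iweight (z : {ffun T -> int}) (v : F) :=
  has_weight E [ffun i => (z i)%:~R / M%:R] v.
Definition weight_vec (z : {ffun T -> int}) (v : F) :=
    (exists d, v \in homog F d) /\ has_iweight z v.
Definition is_weight_vec v := exists z, weight_vec z v.

Lemma iweightE z v i : has_iweight z v -> E i i v = ((z i)%:~R / M%:R) *: v.
Proof. by move/(_ i); rewrite ffunE. Qed.

(** Weights differ by sums of roots, so all are x0 plus an integral vector. By
    [root_tuple] some N - 1 of them add up to a root, which makes (N - 1) x0
    integral. *)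
Lemma weight_vec_span : exists S : seq F, (forall v, v \in S -> is_weight_vec v)
    /\ <<S>>%VS = fullv.
Proof.
have [x0 [d0 [v0 [v0n v0d v0x]]]] := exists_weight.
pose P v := (exists d, v \in homog F d) /\
  exists z : {ffun T -> int}, has_weight E [ffun i => x0 i + (z i)%:~R] v.
have [|v i j [[d vd] [z vz]] U PU||S [SP Sf]] := irr_span act (P := P) simF.
- by move=> v [].
- apply: PU; split; first by exists (s i (+) s j (+) d); apply: (act_homog act).
  exists [ffun l => z l + rootw i j l] => l.
  by rewrite (has_weight_E act i j vz) !ffunE !rmorphD /= !addrA.
- exists v0 => //; split; first by exists d0.
  by exists 0 => i; rewrite v0x !ffunE mulr0z addr0.
have /(seq_choice 0)[w wE] : forall v, v \in S ->
    exists z : {ffun T -> int}, has_weight E [ffun i => x0 i + (z i)%:~R] v.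
  by move=> v /SP[].
have [y [_ yw]] := root_tuple act (w := fun v => [ffun i => x0 i + (w v i)%:~R])
   ab0 (fun v vS => proj1 (SP v vS)) Sf wE.
pose c i : int := rootw a0 b0 i - \sum_l w (y l) i.
have cE i : M%:R * x0 i = (c i)%:~R.
  rewrite /c rmorphB /= -yw rmorph_sum /= -sumrB.
  under eq_bigr do rewrite ffunE addrK.
  by rewrite sumr_const card_ord mulr_natl.
exists S; split=> // v vS; exists [ffun i => c i + M%:R * w v i].
split; first exact: proj1 (SP v vS).
move=> i; rewrite (wE v vS) !ffunE rmorphD /= -cE rmorphM /= rmorph_nat -mulrDr.
by rewrite mulrC mulKf ?M_neq0.
Qed.

Lemma weight_vec_E z i j v : weight_vec z v -> weight_vec [ffun l => z l +
    M%:R * rootw i j l] (E i j v).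
Proof.
move=> [[d vd] vz]; split.
  by exists (s i (+) s j (+) d); apply: (act_homog act).
move=> l; rewrite (has_weight_E act i j vz) 2![in LHS]ffunE 2![in RHS]ffunE.
congr (_ *: _); rewrite rmorphD rmorphM /= rmorph_nat mulrDl; congr (_ + _).
by rewrite mulrAC mulfV ?M_neq0 // mul1r.
Qed.

Lemma is_weight_vec_E i j v : is_weight_vec v -> is_weight_vec (E i j v).
Proof. by case=> z /(weight_vec_E i j); eexists; eassumption. Qed.

Lemma iweight_inj z z' v : v != 0 -> has_iweight z v -> has_iweight z' v -> z =
    z'.
Proof.
move=> v0 vz vz'; apply/ffunP => i; apply/eqP; rewrite -subr_eq0.
rewrite -(intr_eq0_pchar0 _ K0) rmorphB /=.
have /eqP := iweightE i vz; rewrite (iweightE i vz') -subr_eq0 -scalerBl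
    scaler_eq0.
rewrite (negPf v0) orbF -mulrBl mulf_eq0 invr_eq0 (negPf M_neq0) orbF.
by rewrite !subr_eq0 eq_sym.
Qed.

Lemma M_int (z z' : int) : z%:~R / M%:R = z'%:~R :> K -> z = M%:R * z'.
Proof.
move=> /(canRL (divfK M_neq0)) h; apply/eqP; rewrite -subr_eq0.
by rewrite -(intr_eq0_pchar0 _ K0) rmorphB rmorphM /= h rmorph_nat mulrC subrr.
Qed.

Lemma weight_vec_tuple n (t : {ffun 'I_n -> F}) :
    (forall l, is_weight_vec (t l)) ->
  exists p z, homogs p t /\ forall l, has_iweight (z l) (t l).
Proof.
move=> tw.
have /fin_all_exists[z zE] : forall l, exists z, weight_vec z (t l) by [].
have /fin_all_exists[p pE] : forall l, exists d, t l \in homog F d.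
  by move=> l; case: (zE l).
by exists p, z; split=> // l; case: (zE l).
Qed.

Lemma fbr_iweight k p z (t : {ffun 'I_N -> F}) : homogs p t ->
  (forall l, has_iweight (z l) (t l)) -> fbr t != 0 ->
  exists a b, forall i, \sum_(l < N | l != k) z l i = M%:R * rootw a b i.
Proof.
move=> pt tz t0.
have [|a [b ab]] := fbr_weight act (k := k)
   (x := fun l => [ffun i => (z l i)%:~R / M%:R]) pt _ t0; first by move=> l _;
       apply: tz.
exists a, b => i; apply: M_int; rewrite -ab rmorph_sum /= mulr_suml.
by apply: eq_bigr => l _; rewrite ffunE.
Qed.

(** The coordinate sum x_S of a weight is its level for the indicator function
    c of S. *)
Definition level (c : T -> int) (z : {ffun T -> int}) : int := \sum_i c i * z i.

Lemma level_root c a b : level c (rootw a b) = c a - c b.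
Proof.
rewrite /level; under eq_bigr => i _ do rewrite ffunE mulrBr.
rewrite sumrB (bigD1 a) //= (bigD1 b _ (F := fun i => c i * (i == b)%:R)) //=
    !eqxx.
rewrite !big1 ?addr0 ?mulr1 // => i /negPf ->; by rewrite mulr0.
Qed.

Lemma level_linear c (z z' : {ffun T -> int}) m :
  level c [ffun i => z i + m * z' i] = level c z + m * level c z'.
Proof.
rewrite /level mulr_sumr -big_split; apply: eq_bigr => i _.
by rewrite ffunE mulrDr mulrCA.
Qed.

Lemma level_sum (I : finType) (P : pred I) c (z : I -> {ffun T -> int}) :
  level c [ffun i => \sum_(l | P l) z l i] = \sum_(l | P l) level c (z l).
Proof.
rewrite /level exchange_big; apply: eq_bigr => i _.
by rewrite ffunE mulr_sumr.
Qed.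

Lemma root_sum c (I : finType) (P : pred I) (z : I -> {ffun T -> int}) a b :
  (forall i, \sum_(l | P l) z l i = M%:R * rootw a b i) ->
  \sum_(l | P l) level c (z l) = M%:R * (c a - c b).
Proof.
move=> h; rewrite -level_sum -level_root.
rewrite -[RHS]add0r -[0 in RHS](_ : level c 0 = 0); last first.
  by rewrite /level big1 // => i _; rewrite ffunE mulr0.
by rewrite -level_linear; congr level; apply/ffunP => i; rewrite !ffunE h !ffunE
    add0r.
Qed.

(** Only the finitely many weights of a spanning family occur. *)
Lemma exists_max c : exists z v, [/\ weight_vec z v, v != 0 &
  forall z' v', weight_vec z' v' -> v' != 0 -> level c z' <= level c z].
Proof.
have [S [SP Sf]] := weight_vec_span.
have [w wE] := seq_choice 0 SP.
pose S1 : seq F := [seq u <- S | u != 0].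
have key z' v' : weight_vec z' v' -> v' != 0 -> exists2 u, u \in S1 & w u = z'.
  move=> [_ vz'] v0'.
  have [|u [uS u0 uw]] := joint_eigen_span (fun u us => proj2 (wE u us)) vz'
      v0'.
    by rewrite Sf memvf.
  exists u; first by rewrite mem_filter u0.
  apply: (iweight_inj u0); first by case: (wE u uS).
  by move=> i; rewrite -uw; case: (wE u uS) => _ ->.
have [x0 [d0 [v0 [v0n v0d v0x]]]] := exists_weight.
have : S1 != [::].
  apply: contraNneq v0n => S0; rewrite -memv0 -span_nil -S0.
  suff -> : <<S1>>%VS = fullv :> {vspace F} by rewrite memvf.
  apply/eqP; rewrite eqEsubv subvf -Sf; apply/span_subvP => u uS.
  have [->|u0] := eqVneq u 0; first exact: mem0v.
  by rewrite memv_span // mem_filter u0.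
move=> /(seq_argmax (fun u => level c (w u)))[u].
rewrite mem_filter => /andP[u0 uS] um.
exists (w u), u; split=> //; first exact: wE.
by move=> z' v' vz' v0'; have [u' /um + <-] := key _ _ vz' v0'.
Qed.

(** The weights in a tuple that produces the root a - b have total level c a -
    c b > 0, so one of them has positive level. *)
Lemma sign_pos c a b : c a - c b > 0 -> exists z v, [/\ weight_vec z v, v != 0 &
    0 < level c z].
Proof.
move=> cab; have [S [SP Sf]] := weight_vec_span.
have [w wE] := seq_choice 0 SP.
have ab : a != b by apply: contraTneq cab => ->; rewrite subrr ltxx.
have [|y [yS yw]] := root_tuple act (w := fun v =>
    [ffun i => (w v i)%:~R / M%:R])
   ab (S := S) _ Sf (fun v vS => proj2 (wE v vS)).
  by move=> v /wE[].
have : \sum_l level c (w (y l)) > 0.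
  rewrite (root_sum c (z := fun l => w (y l)) (a := a) (b := b)).
    by rewrite mulr_gt0 // ltr0n; case: N N2 => [|[|]].
  move=> i; apply: M_int; rewrite -yw rmorph_sum /= mulr_suml.
  by apply: eq_bigr => l _; rewrite ffunE.
move=> sum_gt; have [l lt_l] : exists l, 0 < level c (w (y l)).
  apply/existsP; apply: contraTT sum_gt => /existsPn h.
  by rewrite -leNgt sumr_le0 // => l _; rewrite leNgt.
by exists (w (y l)), (y l); have [yl y0] := yS l; split=> //; apply: wE.
Qed.

(** The vectors obtained from w by applying operators E i j with (i, j) in L. *)
Inductive word (L : rel T) (w : F) : F -> Prop :=
| word_nil : word L w w
| word_cons i j v : L i j -> word L w v -> word L w (E i j v).

(** A Poincare-Birkhoff-Witt argument: an operator outside L can be moved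
    through a word to w, where it vanishes; the commutators that arise are
    operators applied to shorter words. *)
Lemma word_span (L : rel T) w : is_weight_vec w -> w != 0 ->
  (forall i j, ~~ L i j -> E i j w = 0) ->
  exists S : seq F, (forall v, v \in S -> word L w v) /\ <<S>>%VS = fullv.
Proof.
move=> ww w0 Lw.
have [S [SP PS]] := span_of_pred (word L w).
have UL i j u : L i j -> u \in <<S>>%VS -> E i j u \in <<S>>%VS.
  by move=> Lij; apply: span_linear => v /SP gv; apply: PS; apply: word_cons.
have UE v i j : word L w v -> E i j v \in <<S>>%VS.
  move=> gv; elim: gv i j => [|a b {}v Lab gv IH] i j.
    have [Lij|/Lw->] := boolP (L i j); last exact: mem0v.
    by apply: PS; apply: word_cons => //; apply: word_nil.
  rewrite (act_comm act) memvD ?memvZ // ?memvB ?memvZ //; exact: UL.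
have [|||S' [SP' Sf']] := irr_span act (P := word L w) simF.
- move=> v; elim=> [|i j {}v _ _ [d vd]]; first by case: ww => z [].
  by exists (s i (+) s j (+) d); apply: (act_homog act).
- move=> v i j gv U PU.
  have : (<<S>> <= U)%VS by apply/span_subvP => u /SP/PU.
  by move/subvP; apply; apply: UE.
- by exists w => //; apply: word_nil.
by exists S'.
Qed.

Lemma word_is_weight_vec L w v : is_weight_vec w -> word L w v ->
    is_weight_vec v.
Proof. by move=> ww; elim=> // i j {}v _ _; apply: is_weight_vec_E. Qed.

Lemma level_E c i j (z : {ffun T -> int}) :
  level c [ffun l => z l + M%:R * rootw i j l] = level c z + M%:R * (c i - c j).
Proof. by rewrite level_linear level_root. Qed.

Section Width.
Variable A : pred T.
Let c i : int := (A i)%:R.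

Lemma is_weight_vec_upd n (t : {ffun 'I_n -> F}) k v :
    (forall l, is_weight_vec (t l)) -> is_weight_vec v ->
  forall l, is_weight_vec (upd t k v l).
Proof. by move=> tw vw l; rewrite ffunE; case: eqP. Qed.

(** E i j (fbr (upd t k x)) is a sum over the slots, in which the k-th term is
    the bracket in question and the others are assumed to be 0. *)
Lemma deriv_vanish i j k x (t : {ffun 'I_N -> F}) :
  (forall l, is_weight_vec (t l)) -> is_weight_vec x -> fbr (upd t k x) = 0 ->
  (forall l, l != k -> fbr (upd (upd t k x) l (E i j (t l))) = 0) ->
  fbr (upd t k (E i j x)) = 0.
Proof.
move=> tw xw t0 tl0; have [p [z [pt _]]] := weight_vec_tuple (is_weight_vec_upd
    k tw xw).
have := E_deriv act i j pt; rewrite t0 linear0 (bigD1 k) //=.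
rewrite [X in _ + X]big1 ?addr0; last first.
  move=> l lk; rewrite /slot [upd t k x l]ffunE (negPf lk) tl0 // scaler0 //.
rewrite /slot [upd t k x k]ffunE eqxx upd_upd => /esym/eqP.
by rewrite scaler_eq0 signr_eq0 => /eqP.
Qed.

(** If the levels were spread wider, a bracket with an entry of top level and
    an entry of bottom level would vanish by [fbr_iweight], since leaving out
    the one or the other entry changes the total level by more than 2.
    Operators that do not lower the level propagate this from bottom vectors
    to all vectors in the second slot, and then all operators propagate it in
    the first slot, so the bracket is 0. *)
Lemma width z v z' v' : weight_vec z v -> v != 0 -> weight_vec z' v' -> v' !=
    0 ->
  level c z - level c z' <= M%:R *+ 2.
Proof.
have [zt [vt [vtw vt0 tmax]]] := exists_max c.
have [zl [vl [vlw vl0 lmin]]] := exists_max (fun i => - c i).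
have levN x : level (fun i => - c i) x = - level c x.
  by rewrite /level -sumrN; apply: eq_bigr => i _; rewrite mulNr.
move=> vw v0 vw' v0'.
have {vw v0} h1 := tmax _ _ vw v0.
have {vw' v0'} := lmin _ _ vw' v0'; rewrite !levN lerN2 => h2.
have [le_w|lt_w] := leP (level c zt - level c zl) (M%:R *+ 2); first by lia.
exfalso.
have lt0 : (0 < N)%N by apply: ltn_trans N2.
have lt1 : (1 < N)%N by apply: ltn_trans N2.
pose i0 := Ordinal lt0; pose i1 := Ordinal lt1.
have i01 : i0 != i1 by [].
pose top u := exists x, weight_vec x u /\ level c x = level c zt.
pose Q x := forall t : {ffun 'I_N -> F}, (forall l, is_weight_vec (t l)) ->
    top (t i0) ->
   fbr (upd t i1 x) = 0.
have c01 i : 0 <= c i <= 1 by rewrite /c; case: (A i).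
(* The total weights of the entries other than the first and other than the
   second are both roots or 0. *)
have Qlow : Q vl.
  move=> t tw [x [xt xm]].
  have [p [zz [pt zzt]]] := weight_vec_tuple (is_weight_vec_upd i1 tw
      (ex_intro _ zl vlw)).
  apply/eqP/negPn/negP => nz.
  have z1 : zz i1 = zl.
    by apply: (iweight_inj vl0); [have := zzt i1; rewrite upd_same | case: vlw].
  have t0 : t i0 != 0.
    apply: contraNneq nz => t0; rewrite -(upd_id (upd t i1 vl) i0) ffunE
        (negPf i01) t0.
    by rewrite -/(slot _ _ _) linear0.
  have z0 : zz i0 = x.
    apply: (iweight_inj t0); last by case: xt.
    by have := zzt i0; rewrite ffunE (negPf i01).
  have [a [b /(root_sum c)]] := fbr_iweight i1 pt zzt nz.
  have [a' [b' /(root_sum c)]] := fbr_iweight i0 pt zzt nz.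
  rewrite (bigD1 i1) ?[i1 == i0]eq_sym // (bigD1 i0 (P := fun l => l != i1)) //=
      z0 z1.
  rewrite [X in _ + X = _ -> _](eq_bigl (fun l => (l != i1) && (l != i0)));
      last first.
    by move=> l; rewrite andbC.
  set R := \sum_(_ | _) _.
  have bnd x1 y1 : - M%:R <= M%:R * (c x1 - c y1) <= M%:R.
    have M0 : 0 <= (M%:R : int) by [].
    move: (c01 x1) (c01 y1) M0; move: (c x1) (c y1) (M%:R : int); nia.
  have := bnd a b; have := bnd a' b' => h3 h4 h5 h6; move: lt_w h3 h4.
  by rewrite -h5 -h6 xm; lia.
pose L := [rel i j | c j <= c i].
(* Raising the top vector in the first slot gives 0, and an operator that
   keeps its level gives a top vector again. *)
have QE i j v1 : L i j -> is_weight_vec v1 -> Q v1 -> Q (E i j v1).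
  move=> /= Lij v1w Qv t tw tt; apply: deriv_vanish => //; first exact: Qv.
  move=> l l1; rewrite updC 1?eq_sym //.
  have [l0|l0] := eqVneq l i0; last first.
    apply: Qv; last by rewrite ffunE eq_sym (negPf l0).
    by apply: is_weight_vec_upd => //; apply: is_weight_vec_E.
  have [x [xt xm]] := tt; have xt' := weight_vec_E i j xt; have xl :=
      level_E c i j x.
  have [e0|ne0] := eqVneq (E i j (t i0)) 0.
    by rewrite l0 e0 updC // -/(slot _ _ _) linear0.
  apply: Qv; first by apply: is_weight_vec_upd => //; apply: is_weight_vec_E.
  rewrite l0 upd_same; exists [ffun l => x l + M%:R * rootw i j l]; split=> //.
  have := tmax _ _ xt' ne0; rewrite xl xm => le; apply/eqP; rewrite eq_le le /=.
  by rewrite lerDl mulr_ge0 // subr_ge0.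
have vlL i j : ~~ L i j -> E i j vl = 0.
  rewrite /= -ltNge => lt; apply/eqP/negPn/negP => nz.
  have := lmin _ _ (weight_vec_E i j vlw) nz; rewrite !levN level_E lerN2.
  by rewrite lerDl pmulr_rge0 ?subr_ge0 ?leNgt ?lt // ltr0n; case: N N2 =>
      [|[|]].
have Qall v1 : word L vl v1 -> Q v1.
  by elim=> // i j v2 Lij gv; apply: QE => //; apply: word_is_weight_vec gv;
      exists zl.
have [S [SP Sf]] := word_span (ex_intro _ zl vlw) vl0 vlL.
have top0 (t : {ffun 'I_N -> F}) : (forall l, is_weight_vec (t l)) ->
    top (t i0) -> fbr t = 0.
  move=> tw tt; rewrite -[t](upd_id _ i1) -/(slot t i1 (t i1)).
  have /(span_linear (f := slot t i1)) H : forall u, u \in S ->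
      slot t i1 u \in (0%VS : {vspace F}).
    by move=> u /SP/Qall Qu; rewrite memv0; apply/eqP/Qu.
  by apply/eqP; rewrite -memv0; apply: H; rewrite Sf memvf.
pose Z x := is_weight_vec x /\ forall t : {ffun 'I_N -> F},
    (forall l, is_weight_vec (t l)) ->
  fbr (upd t i0 x) = 0.
have [v1|v1 i j [v1w Zv] U PU||S' [SZ Sf']] := irr_span act (P := Z) simF.
- by case=> -[z1 []].
- apply: PU; split=> [|t tw]; first exact: is_weight_vec_E.
  apply: deriv_vanish => //; first exact: Zv.
  move=> l l0; rewrite updC 1?eq_sym //; apply: Zv; apply: is_weight_vec_upd =>
      //.
  exact: is_weight_vec_E.
- exists vt => //; split=> [|t tw]; first by exists zt.
  apply: top0; first by apply: is_weight_vec_upd => //; exists zt.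
  by rewrite upd_same; exists zt.
have [[x nz] _] := simF; apply: nz; apply/eqP; rewrite -memv0.
apply: (@multilin_span K F F N (@fbr _ _ F) (fun=> S')).
- by move=> y j a u v1; apply: fbr_linear.
- move=> y yS; rewrite memv0 -[y](upd_id _ i0); apply/eqP.
  by case: (SZ _ (yS i0)) => _; apply=> l; case: (SZ _ (yS l)).
- by move=> j; rewrite Sf' memvf.
Qed.
End Width.
End IntWeights.

(** * The Casimir operator *)

Section Casimir.
Variables (K : fieldType) (N : nat) (F : filippovSuperalgebra K N).
Variables (T : finType) (s : T -> bool) (E : T -> T -> 'End(F)).
Hypothesis act : mxaction s E.
Local Notation eps i := ((-1) ^+ s i : K).

Definition casimir (v : F) : F := \sum_i \sum_j eps j *: E i j (E j i v).
Lemma casimir_is_linear : linear casimir.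
Proof.
move=> a u v; rewrite /casimir scaler_sumr -big_split; apply: eq_bigr => i _ /=.
rewrite scaler_sumr -big_split; apply: eq_bigr => j _ /=.
by rewrite !linearP.
Qed.
HB.instance Definition _ := GRing.isLinear.Build K F F _ casimir
    casimir_is_linear.

Definition sdim : K := \sum_i eps i.

Lemma sum_delta (f : T -> F) l : \sum_i (i == l)%:R *: f i = f l.
Proof.
rewrite (bigD1 l) //= eqxx scale1r big1 ?addr0 // => i /negPf->.
by rewrite scale0r.
Qed.

(** The Casimir element with an operator X inserted between its two factors. *)
Definition twisted_casimir (X : 'End(F)) (v : F) : F :=
  \sum_i \sum_j eps j *: E i j (twist (s i (+) s j) X (E j i v)).

Lemma twisted_casimir_unit k l v : twisted_casimir (E k l) v =
  E k l (casimir v) - \sum_j eps j *: E k j (E j l v)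
  + \sum_i (eps k * (-1) ^+ ((s i (+) s k) && (s k (+) s l))) *:
      E i l (E k i v).
Proof.
pose g i j : K := (-1) ^+ ((s i (+) s j) && (s k (+) s l)).
have gK i j (u : F) : g i j *: (g i j *: u) = u.
  by rewrite scalerA -expr2 sqrr_sign scale1r.
transitivity (\sum_i \sum_j (eps j *: E k l (E i j (E j i v))
   - (i == l)%:R *: (eps j *: E k j (E j i v))
   + (j == k)%:R *: ((eps j * g i j) *: E i l (E j i v)))).
  apply: eq_bigr => i _; apply: eq_bigr => j _.
  rewrite (twistE _ (act_homog act k l)) scale_lfunE linearZ /=
      (act_comm act i j k l).
  rewrite -/(g i j) scalerDr gK scalerDr scalerBr.
  congr (_ - _ + _); rewrite !scalerA; first by rewrite mulrC.
  by congr (_ *: _); ring.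
under eq_bigr => i _ do rewrite big_split sumrB /=.
rewrite big_split sumrB /=; congr (_ - _ + _).
- rewrite linear_sum; apply: eq_bigr => i _; rewrite linear_sum.
  by apply: eq_bigr => j _; rewrite linearZ.
- under eq_bigr => i _ do rewrite -scaler_sumr.
  by rewrite sum_delta.
- by apply: eq_bigr => i _; rewrite sum_delta.
Qed.

Lemma casimir_comm k l v : casimir (E k l v) = E k l (casimir v).
Proof.
have H : casimir (E k l v) = twisted_casimir (E k l) v
    - \sum_i (eps l * (-1) ^+ ((s i (+) s l) && (s k (+) s l))) *:
        E i l (E k i v)
    + \sum_j eps j *: E k j (E j l v).
  pose g i j : K := (-1) ^+ ((s i (+) s j) && (s k (+) s l)).
  transitivity (\sum_i \sum_j (eps j *: E i j (twist (s i (+) s j) (E k l)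
      (E j i v))
    - (j == l)%:R *: ((eps j * g i j) *: E i j (E k i v))
    + (i == k)%:R *: (eps j *: E i j (E j l v)))).
    apply: eq_bigr => i _; apply: eq_bigr => j _.
    rewrite (twistE _ (act_homog act k l)) scale_lfunE (act_comm act j i k l).
    rewrite [s j (+) s i]addbC.
    rewrite [E i j (_ + _)]linearD /= [E i j (_ *: (_ - _))]linearZ /=.
    rewrite [E i j (_ - _)]linearB /= ![E i j (_ *: _)]linearZ /= -/(g i j).
    rewrite scalerDr scalerBr scalerBr; congr (_ - _ + _); rewrite !scalerA //.
      by congr (_ *: _); ring.
    by congr (_ *: _); ring.
  under eq_bigr => i _ do rewrite big_split sumrB /=.
  rewrite big_split sumrB /=; congr (_ - _ + _).
    by apply: eq_bigr => i _; rewrite sum_delta.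
  under eq_bigr => i _ do rewrite -scaler_sumr.
  by rewrite sum_delta.
rewrite H twisted_casimir_unit.
set A := \sum_j _; set B := \sum_i _; set C := \sum_i _.
suff -> : B = C by rewrite addrK subrK.
apply: eq_bigr => i _; congr (_ *: _).
by rewrite -!signr_addb; congr ((-1) ^+ (nat_of_bool _)); case: (s i); case:
    (s k); case: (s l).
Qed.

(** Moving X = E k l out to the left leaves a commutator term, which is half
    the Casimir scalar of the adjoint module, here the superdimension of the
    natural one. *)
Lemma twisted_casimir_act k l v : twisted_casimir (E k l) v =
    E k l (casimir v) - sdim *: E k l v.
Proof.
rewrite twisted_casimir_unit -addrA; congr (_ + _).
rewrite [X in _ + X](eq_bigr (fun i => (eps i *: E k i (E i l v) - eps i *: E k
    l v)
   + (l == k)%:R *: (eps k *: E i i v))); last first.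
  move=> i _; rewrite (act_comm act i l k i) eqxx scale1r scalerDr.
  rewrite [in LHS]scalerA [in LHS]scalerA.
  have -> : eps k * (-1) ^+ ((s i (+) s k) && (s k (+) s l)) *
      (-1) ^+ ((s i (+) s l) && (s k (+) s i)) = eps i.
    rewrite -!signr_addb; congr ((-1) ^+ (nat_of_bool _)).
    by case: (s i); case: (s k); case: (s l).
  rewrite scalerBr; congr (_ + _); case: eqP => [->|_]; last by rewrite mulr0
      !scale0r.
  by rewrite addbb andbF !mulr1 scale1r.
rewrite big_split sumrB /= -scaler_sumr -scaler_sumr (act_trace act).
by rewrite !scaler0 addr0 -scaler_suml addrA addNr add0r.
Qed.

Lemma twisted_casimir_ad (X : 'End(F)) v : is_ad X -> twisted_casimir X v =
    X (casimir v) - sdim *: X v.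
Proof.
move=> /(act_ad act)[c ->].
have twl (I : finType) (G : I -> 'End(F)) : twisted_casimir (\sum_i G i) v =
    \sum_i twisted_casimir (G i) v.
  rewrite /twisted_casimir [RHS]exchange_big; apply: eq_bigr => i _ /=.
  rewrite [RHS]exchange_big; apply: eq_bigr => j _ /=.
  by rewrite linear_sum sum_lfunE linear_sum scaler_sumr.
rewrite twl !sum_lfunE scaler_sumr -sumrB; apply: eq_bigr => k _.
rewrite twl !sum_lfunE scaler_sumr -sumrB; apply: eq_bigr => l _.
rewrite !scale_lfunE scalerA mulrC -scalerA -scalerBr -twisted_casimir_act
    /twisted_casimir scaler_sumr.
apply: eq_bigr => i _; rewrite scaler_sumr; apply: eq_bigr => j _.
by rewrite linearZ /= scale_lfunE linearZ /= !scalerA mulrC.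
Qed.

(** Only one of the two factors of the Casimir element is distributed over the
    slots by the derivation rule. In the k-th term that follows, the bracket
    is ad_k of the other entries, so the other factor completes a twisted
    Casimir operator around ad_k: each slot contributes c - sdim, without any
    sum over pairs of slots. *)
Lemma casimir_fbr c p (t : {ffun 'I_N -> F}) : homogs p t ->
  (forall v, casimir v = c *: v) -> c *: fbr t = (N%:R * (c - sdim)) *: fbr t.
Proof.
move=> pt casE; rewrite -casE /casimir.
pose m (k : 'I_N) := \big[addb/false]_(l < N | (l < k)%N) p l.
pose m' (k : 'I_N) := \big[addb/false]_(l < N | (k < l)%N) p l.
transitivity (\sum_(k < N) \sum_i \sum_j eps j *: E i j
   ((-1) ^+ (m k && (s i (+) s j)) *: slot t k (E j i (t k)))).
  rewrite [RHS]exchange_big; apply: eq_bigr => i _ /=.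
  rewrite [RHS]exchange_big; apply: eq_bigr => j _ /=.
  rewrite -scaler_sumr -linear_sum; congr (_ *: E _ _ _).
  by rewrite (E_deriv act _ _ pt); apply: eq_bigr => k _; rewrite addbC.
transitivity (\sum_(k < N) (c - sdim) *: fbr t); last first.
  by rewrite sumr_const card_ord mulr_natl scalerMnl.
apply: eq_bigr => k _.
pose X := ad k (del k p) (delf k t).
have pd : homogs (del k p) (delf k t) by apply: homogs_del.
have adX : is_ad X by exists k, (del k p), (delf k t).
have Xpar : \big[addb/false]_l del k p l = m k (+) m' k.
  rewrite (big_del _ k xpredT) (bigID (fun l : 'I_N => (l < k)%N)) /=;
      congr (_ (+) _).
    apply: eq_bigl => l; rewrite andbT andbC -val_eqE /=; case: ltngtP => //.
  apply: eq_bigl => l; rewrite andbT -val_eqE /=; by case: ltngtP.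
transitivity ((-1) ^+ (p k && m' k) *: twisted_casimir X (t k)).
  rewrite /twisted_casimir scaler_sumr; apply: eq_bigr => i _.
  rewrite scaler_sumr; apply: eq_bigr => j _.
  rewrite (ad_slot _ pt (act_homog act j i (pt k))) -/X.
  rewrite (twistE _ (ad_homog k pd)) -/X Xpar scale_lfunE !linearZ /= !scalerA.
  congr (_ *: _); rewrite -!signr_addb; congr ((-1) ^+ (nat_of_bool _)).
  rewrite -/(m' k).
  by case: (s i); case: (s j); case: (p k); case: (m k); case: (m' k).
rewrite (twisted_casimir_ad _ adX) casE linearZ /= -scalerBl scalerA
    mulrC -scalerA.
by rewrite -(ad_slot _ pt (pt k)) /slot upd_id.
Qed.

Lemma fbr_homog_neq0 : fsimple F -> exists p (t : {ffun 'I_N -> F}),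
    homogs p t /\ fbr t != 0.
Proof.
move=> [[x nz] _]; apply: NNPP => no; apply: nz; apply/eqP; rewrite -memv0.
apply: (@multilin_span K F F N (@fbr _ _ F) (fun=> hbasis F)).
- by move=> y j a u v1; apply: fbr_linear.
- move=> y yS; rewrite memv0; apply/negPn/negP => y0; apply: no.
  have /fin_all_exists[p pE] : forall l, exists d, y l \in homog F d.
    by move=> l; apply: hbasis_homog.
  by exists p, y.
- by move=> j; rewrite hbasis_span memvf.
Qed.

Lemma casimir_scalar c v d : fsimple F -> v != 0 -> v \in homog F d ->
    casimir v = c *: v ->
  forall u, casimir u = c *: u.
Proof.
move=> simF v0 vd vc.
pose P u := (exists d, u \in homog F d) /\ casimir u = c *: u.
have [u|u i j [[e ue] uc] U PU||S [SP Sf] u] := irr_span act (P := P) simF.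
- by case.
- apply: PU; split; first by exists (s i (+) s j (+) e); apply: (act_homog act).
  by rewrite casimir_comm uc linearZ.
- by exists v => //; split=> //; exists d.
pose f u := casimir u - c *: u.
have fl : linear f.
  move=> a x y; rewrite /f linearP /= !scalerDr opprD addrACA.
  by rewrite scalerN !scalerA mulrC.
pose fM := GRing.isLinear.Build _ _ _ _ f fl.
pose fL : {linear F -> F} := HB.pack f fM.
have /(span_linear (f := fL)) H : forall w, w \in S ->
    fL w \in (0%VS : {vspace F}).
  by move=> w /SP[_ wc]; rewrite memv0 /= /f wc subrr.
apply/eqP; rewrite -subr_eq0 -memv0; apply: (H u); by rewrite Sf memvf.
Qed.

(** For i before j, the summand E i j (E j i v) is computed by commuting the
    raising operator E i j to v; for i after j it is 0. *)
Lemma casimir_highest (ord : T -> nat) (x : {ffun T -> K}) v : injective ord ->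
  (forall i j, (ord i < ord j)%N -> E i j v = 0) -> has_weight E x v ->
  casimir v = (\sum_i eps i * x i ^+ 2 +
    \sum_i \sum_(j | (ord i < ord j)%N) eps j * (x i - (-1) ^+ (s i (+) s j) * x
        j)) *: v.
Proof.
move=> ord_inj vE vx; rewrite /casimir scalerDl !scaler_suml -big_split.
apply: eq_bigr => i _ /=.
rewrite (bigD1 i) //= (vx i) linearZ /= (vx i) !scalerA -mulrA -expr2;
    congr (_ + _).
rewrite scaler_suml (bigID (fun j => (ord i < ord j)%N)) /=.
rewrite [X in _ + X]big1 ?addr0; last first.
  move=> j /andP[ji]; rewrite -leqNgt leq_eqVlt => /orP[/eqP/ord_inj ij|/vE->].
    by rewrite ij eqxx in ji.
  by rewrite linear0 scaler0.
apply: eq_big => j; first by case: eqP => // ->; rewrite ltnn.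
move=> /andP[_ /vE ij0]; rewrite (act_comm act) ij0 linear0 !eqxx !scale1r
    sub0r.
rewrite (vx i) (vx j) [s j (+) s i]addbC andbb scalerN addrC scalerA -scalerBl.
by rewrite scalerA.
Qed.

End Casimir.

(** * The highest weight *)

Section Facts.
Variables (K : closedFieldType) (N : nat) (F : filippovSuperalgebra K N).
Variables (T : finType) (s : T -> bool) (E : T -> T -> 'End(F)).
Hypothesis act : mxaction s E.
Hypothesis K0 : [pchar K] =i pred0.
Hypothesis simF : fsimple F.
Hypothesis F0 : homog F false <> 0%VS.
Hypothesis N2 : (2 < N)%N.
Variables a0 b0 : T.
Hypothesis ab0 : a0 != b0.

Local Notation M := (N.-1).

Local Notation weight_vec := (weight_vec E).

Lemma M_gt0 : 0 < (M%:R : int).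
Proof. by rewrite ltr0n; case: N N2 => [|[|]]. Qed.

Lemma level_pred1 a (z : {ffun T -> int}) : level (fun i => (pred1 a i)%:R) z =
    z a.
Proof.
rewrite /level (bigD1 a) //= eqxx mul1r big1 ?addr0 // => i /negPf->.
by rewrite mul0r.
Qed.

Lemma E_opp i j v : i != j -> E i j (E j i v) =
  (-1) ^+ (s i (+) s j) *: (E j i (E i j v) - E j j v) + E i i v.
Proof.
by move=> ij; rewrite (act_comm act) !eqxx !scale1r [s j (+) s i]addbC andbb.
Qed.

Lemma int_eq (x y : int) : x%:~R = y%:~R :> K -> x = y.
Proof.
move=> /eqP; rewrite -subr_eq0 -rmorphB /= intr_eq0_pchar0 // subr_eq0.
by move=> /eqP.
Qed.

Lemma scale_frac (x : int) (v : F) : v != 0 -> (x%:~R / M%:R : K) *: v = 0 ->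
    x = 0.
Proof.
move=> v0 /eqP; rewrite scaler_eq0 (negPf v0) orbF mulf_eq0 invr_eq0.
by rewrite (negPf (M_neq0 K0 N2)) orbF intr_eq0_pchar0 // => /eqP.
Qed.

(** By the width bound for the i-th coordinate, E j i cubed kills w; by sl2
    theory the string through w has length z i - z j, which is then at most 2. *)
Lemma string_length i j z w : i != j -> s i = s j -> weight_vec z w -> w != 0 ->
  E i j w = 0 -> [\/ z i - z j = 0, z i - z j = M%:R | z i - z j = M%:R *+ 2].
Proof.
move=> ij sij wz w0 ew; have [_ wzE] := wz.
have wz1 := weight_vec_E act K0 N2 j i wz; have wz2 := weight_vec_E act K0 N2 j
    i wz1; have wz3 := weight_vec_E act K0 N2 j i wz2.
have ji : j != i by rewrite eq_sym.
have f3 : E j i (E j i (E j i w)) = 0.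
  apply/eqP/negPn/negP => nz; have := width act K0 simF F0 N2 ab0 (pred1 i) wz
      w0 wz3 nz.
  rewrite !level_pred1 !ffunE eqxx [i == j](negPf ij); have := M_gt0; lia.
have step z' u : weight_vec z' u -> E i j (E j i u) =
    E j i (E i j u) + ((z' i - z' j)%:~R / M%:R : K) *: u.
  move=> [_ uz]; rewrite E_opp // sij addbb scale1r (iweightE i uz)
      (iweightE j uz).
  by rewrite rmorphB /= mulrBl scalerBl addrA addrAC.
(* E i j (E j i)^k w is k (n - k + 1) times (E j i)^(k-1) w, with n the
   difference of the weight coordinates. *)
have e1 := step _ _ wz; rewrite ew linear0 add0r in e1.
have e2 := step _ _ wz1; rewrite e1 linearZ /= -scalerDl in e2.
have e3 := step _ _ wz2; rewrite e2 linearZ /= -scalerDl f3 linear0 in e3.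
set n := z i - z j in e1 e2 e3 *.
rewrite !ffunE !eqxx [i == j](negPf ij) [j == i](negPf ji) in e2 e3.
have [f2|f2] := eqVneq (E j i (E j i w)) 0; last first.
  apply: Or33; move/esym: e3; rewrite -!mulrDl -!rmorphD => /(scale_frac f2).
  by rewrite /n; lia.
have [f1|f1] := eqVneq (E j i w) 0; last first.
  apply: Or32; move/esym: e2; rewrite f2 linear0 -!mulrDl -!rmorphD =>
      /(scale_frac f1).
  by rewrite /n; lia.
apply: Or31; move/esym: e1; rewrite f1 linear0 => /(scale_frac w0); by [].
Qed.

(** For an odd root the square of the lowering operator is 0, and the string
    is governed by the value of the weight on E k k + E f f. *)
Lemma odd_step k f z v : s k != s f -> weight_vec z v -> E k f v = 0 ->
  E k f (E f k v) = ((z k + z f)%:~R / M%:R : K) *: v.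
Proof.
move=> skf [_ vz] kf; have kf' : k != f by apply: contraNneq skf => ->.
rewrite E_opp // kf linear0 sub0r addbC -negb_eqb eq_sym skf expr1 scalerN
    scaleN1r opprK.
by rewrite (iweightE k vz) (iweightE f vz) -scalerDl rmorphD /= -mulrDl addrC.
Qed.

Lemma odd_step_eq0 k f z v : s k != s f -> weight_vec z v -> v != 0 -> E k f v =
    0 ->
  E f k v = 0 -> z k + z f = 0.
Proof.
move=> skf vz v0 kf fk; have := odd_step skf vz kf.
by rewrite fk linear0 => /esym/(scale_frac v0).
Qed.

Lemma E_kill i j k l v : i != l -> j != k -> E i j v = 0 -> E i j (E k l v) = 0.
Proof.
move=> il jk ev; rewrite (act_comm act) (negPf il) (negPf jk) ev linear0.
by rewrite !scale0r subrr scaler0 addr0.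
Qed.

Lemma E_killr i j k v : i != k -> E i j v = 0 -> E i k v = 0 ->
    E i j (E j k v) = 0.
Proof.
move=> ik ev ek; rewrite (act_comm act) (negPf ik) eqxx ev ek linear0.
by rewrite scale0r subrr !scaler0 addr0.
Qed.

(** The three operators E f i, E f j, E f k lower the level of the block of i,
    j, k by 3 in total, so their product kills v. The first factor that
    produces 0 gives the equation, the later ones being shifted by the weights
    of the operators already applied. *)
Lemma odd_triple i j k f z v : weight_vec z v -> v != 0 -> i != j -> i != k ->
    j != k ->
  s i = s j -> s j = s k -> s k != s f ->
  E i j v = 0 -> E i k v = 0 -> E j k v = 0 ->
  E i f v = 0 -> E j f v = 0 -> E k f v = 0 ->
  [\/ z k + z f = 0, z j + z f + M%:R = 0 | z i + z f + M%:R *+ 2 = 0].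
Proof.
move=> vz v0 ij ik jk sij sjk skf eij eik ejk eif ejf ekf.
have sjf : s j != s f by rewrite sjk.
have sif : s i != s f by rewrite sij.
have nf l : s l != s f -> l != f by apply: contraNneq => ->.
have [iF jF kF] : [/\ i != f, j != f & k != f] by split; apply: nf.
have vz1 := weight_vec_E act K0 N2 f k vz; have vz2 := weight_vec_E act K0 N2 f
    j vz1; have vz3 := weight_vec_E act K0 N2 f i vz2.
have [y1|y1] := eqVneq (E f k v) 0; first by apply: Or31; apply:
    (odd_step_eq0 skf vz).
have jf1 : E j f (E f k v) = 0 by apply: E_killr.
have [y2|y2] := eqVneq (E f j (E f k v)) 0.
  apply: Or32; have := odd_step_eq0 sjf vz1 y1 jf1 y2; rewrite !ffunE eqxx.
  by rewrite (negPf jF) (negPf jk) [f == k]eq_sym (negPf kF) subrr subr0 mulr0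
      mulr1 addr0 addrA.
have if2 : E i f (E f j (E f k v)) = 0.
  by apply: E_killr => //; [apply: E_killr | apply: E_kill].
have [y3|y3] := eqVneq (E f i (E f j (E f k v))) 0.
  apply: Or33; have := odd_step_eq0 sif vz2 y2 if2 y3; rewrite !ffunE eqxx.
  rewrite (negPf iF) (negPf ij) (negPf ik) [f == k]eq_sym (negPf kF).
  by rewrite [f == j]eq_sym (negPf jF) subrr !subr0 mulr0 !mulr1 !addr0 mulr2n
      !addrA.
have := width act K0 simF F0 N2 ab0 [pred l | s l == s k] vz v0 vz3 y3.
rewrite 3!level_E /= eqxx sij sjk eqxx [s f == s k]eq_sym (negPf skf).
by have := M_gt0; move: (level _ z) (M%:R : int) => x m; clear; lia.
Qed.

Variables (P : pred T) (ord : T -> nat) (t : bool).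
Hypothesis ord_inj : injective ord.
Hypothesis Ps : forall i, s i = if P i then t else ~~ t.
Hypothesis ordP : forall i j, P i -> ~~ P j -> (ord i < ord j)%N.
Variables p0 q0 : T.
Hypotheses (Pp0 : P p0) (Pq0 : ~~ P q0).

Let eps i : int := (-1) ^+ (~~ P i).
Let ind i : int := (P i)%:R.

(** A highest weight for the order ord, in which the block P comes first; all
    coordinates are multiplied by N - 1. The last conjunct is the Casimir
    identity, with the scalar (Lambda, Lambda + 2 rho) on the left, multiplied
    by (N - 1)^2. *)
Lemma highest_facts : exists z : {ffun T -> int},
  [/\ \sum_i z i = 0,
      0 < level ind z < M%:R *+ 2,
      (forall f, ~~ P f -> - (M%:R *+ 2) < z f),
      (forall i j, (ord i < ord j)%N -> P i = P j ->
        [\/ z i - z j = 0, z i - z j = M%:R | z i - z j = M%:R *+ 2])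
    & [/\ (forall i j k f, P k -> ~~ P f -> (ord i < ord j)%N ->
        (ord j < ord k)%N ->
        [\/ z k + z f = 0, z j + z f + M%:R = 0 | z i + z f + M%:R *+ 2 = 0]),
      (forall i k f, P k -> ~~ P f -> (ord i < ord k)%N -> z k + z f != 0 ->
         [\/ z i - z k + M%:R = 0, z i - z k = 0 | z i - z k = M%:R])
    & \sum_i eps i * z i ^+ 2 + M%:R * \sum_i \sum_(j | (ord i < ord j)%N)
          eps j * (z i - eps i * eps j * z j) = N%:R * M%:R * \sum_i eps i]].
Proof.
(* The functional - ord decreases strictly along the order, so a weight
   maximal for it is a highest weight. *)
have [z [v [vz v0 vmax]]] :=
  exists_max act K0 simF F0 N2 ab0 (fun i => - (ord i)%:R).
have M0 := M_gt0.
have ordn i j : (ord i < ord j)%N -> i != j by apply: contraTneq => ->;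
    rewrite ltnn.
have up i j : (ord i < ord j)%N -> E i j v = 0.
  move=> lt_ij; apply/eqP/negPn/negP => nz.
  have := vmax _ _ (weight_vec_E act K0 N2 i j vz) nz; rewrite level_E; move:
      lt_ij M0; nia.
have PE i j : P i = P j -> s i = s j by rewrite !Ps => ->.
have PN i j : P i -> ~~ P j -> s i != s j.
  by rewrite !Ps => -> /negPf->; case: (t).
have Pord i j : P j -> (ord i < ord j)%N -> P i.
  by move=> Pj ij; apply: contraLR ij => /(ordP Pj); rewrite -leqNgt => /ltnW.
have pq0 : p0 != q0 by apply: contraNneq Pq0 => <-.
exists z; split; last split.
- apply: (scale_frac v0); have [_ vzE] := vz; rewrite rmorph_sum mulr_suml
    scaler_suml /=.
  rewrite -[RHS](act_trace act v); apply: eq_bigr => i _;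
      by rewrite (iweightE i vzE).
(* The lowering operators do not raise the level of the block P, so the
   highest weight also has the largest level. *)
- have ltmax z' v' : weight_vec z' v' -> v' != 0 -> level ind z' <= level ind z.
    move=> vz' v0'.
    pose L := [rel i j | ind i <= ind j].
    have genL u : word E L v u -> exists z1, weight_vec z1 u /\ level ind z1 <=
        level ind z.
      elim=> [|i j {}u Lij _ [z1 [uz le_z]]]; first by exists z.
      exists [ffun l => z1 l + M%:R * rootw i j l]; split; first exact:
          (weight_vec_E act K0 N2 i j uz).
      by rewrite level_E; move: Lij M0 le_z => /=; nia.
    have [|S [SP Sf]] := word_span act (L := L) simF (ex_intro _ z vz) v0.
      move=> i j; rewrite /= /ind => Lij; apply: up; apply: ordP.
        by move: Lij; case: (P i) => //; case: (P j).
      by move: Lij; case: (P j) => //; case: (P i).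
    have [w wE] := seq_choice 0 (fun u uS => genL u (SP u uS)).
    have [|u [uS u0 uw]] := joint_eigen_span (fun u us =>
        proj2 (proj1 (wE u us))) (proj2 vz') v0'.
      by rewrite Sf memvf.
    have -> : z' = w u.
      apply: (iweight_inj K0 N2 u0); last by case: (wE u uS) => -[_ h] _.
      by move=> i; rewrite -uw; case: (wE u uS) => -[_ ->].
    by case: (wE u uS).
  have [|z1 [v1 [vz1 v10 lt1]]] := sign_pos act K0 simF F0 N2 ab0 (c := ind)
      (a := p0) (b := q0).
    by rewrite /ind Pp0 (negPf Pq0); clear; lia.
  have [|z2 [v2 [vz2 v20 lt2]]] := sign_pos act K0 simF F0 N2 ab0 (c :=
      fun i => - ind i) (a := q0) (b := p0).
    by rewrite /ind Pp0 (negPf Pq0); clear; lia.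
  have levN x : level (fun i => - ind i) x = - level ind x.
    by rewrite /level -sumrN; apply: eq_bigr => i _; rewrite mulNr.
  have := ltmax _ _ vz1 v10; have := width act K0 simF F0 N2 ab0 P vz v0 vz2
      v20.
  by move: lt1 lt2; rewrite levN -/ind; lia.
- move=> f Pf; have fp : f != p0 by apply: contraNneq Pf => ->.
  have [|z1 [v1 [vz1 v10]]] := sign_pos act K0 simF F0 N2 ab0 (c := fun i =>
      (pred1 f i)%:R) (a := f) (b := p0).
    by rewrite /= eqxx eq_sym (negPf fp).
  by rewrite level_pred1 => lt1; have := width act K0 simF F0 N2 ab0 (pred1 f)
      vz1 v10 vz v0; rewrite !level_pred1; lia.
- by move=> i j ij Pij; apply: (string_length (ordn _ _ ij) (PE _ _ Pij) vz) =>
    //; apply: up.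
- move=> i j k f Pk Pf ij jk; have ik := ltn_trans ij jk.
  have [Pj Pi] : P j /\ P i by split; apply: Pord Pk _.
  by apply: (odd_triple vz) => //; do ?[exact: ordn | exact: up | apply: PN |
      apply: PE];
    rewrite ?Pi ?Pj ?Pk //; apply: up; apply: ordP.
- move=> i k f Pk Pf ik kf0; have Pi := Pord _ _ Pk ik; have skf :=
    PN _ _ Pk Pf.
  have ekf : E k f v = 0 by apply: up; apply: ordP.
  have [y1|y1] := eqVneq (E f k v) 0.
    by have := odd_step_eq0 skf vz v0 ekf y1 => /eqP; rewrite (negPf kf0).
  have iF : i != f by apply: contraNneq Pf => <-.
  have kF : k != f by apply: contraNneq Pf => <-.
  have ikE : E i k (E f k v) = 0 by apply: E_kill => //;
      [exact: ordn | exact: up].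
  have := string_length (ordn _ _ ik) (PE i k _) (weight_vec_E act K0 N2 f k vz)
      y1.
  rewrite !ffunE eqxx (negPf iF) (negPf kF) (negPf (ordn _ _ ik)).
  rewrite subr0 sub0r !mulr0 !addr0 mulrN1 Pi Pk ikE.
  have e : z i - (z k - M%:R) = z i - z k + M%:R by ring.
  rewrite e => /(_ erefl erefl)[h|h|h];
      [exact: Or31 | apply: Or32 | apply: Or33].
    by apply: (addIr M%:R); rewrite add0r.
  by apply: (addIr M%:R); rewrite h mulr2n.
have [_ vzE] := vz; have vcas := casimir_highest act ord_inj up vzE.
set c := _ + _ in vcas.
have [[d vd] _] := vz.
have casc := casimir_scalar act simF v0 vd vcas.
have [p [x [px x0]]] := fbr_homog_neq0 simF.
have /eqP := casimir_fbr act px casc; rewrite -subr_eq0 -scalerBl scaler_eq0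
    (negPf x0) orbF.
rewrite subr_eq0 => /eqP cN.
have MN : N%:R = M%:R + 1 :> K by rewrite natr1; case: (N) N2.
have {cN} cM : c * M%:R = N%:R * sdim K s.
  have : N%:R * c - c = N%:R * sdim K s by rewrite {2}cN; ring.
  by rewrite {1}MN => <-; ring.
pose tau : K := (-1) ^+ t.
have sE l : (-1) ^+ s l = tau * (eps l)%:~R :> K.
  rewrite /tau /eps Ps; case: (P l) => /=; first by rewrite mulr1.
  by rewrite signrN rmorphN /= mulrN1.
have tau2 : tau * tau = 1 by rewrite -expr2 sqrr_sign.
have tau0 : tau != 0 by rewrite signr_eq0.
have Mn0 : M%:R != 0 :> K := M_neq0 K0 N2.
apply: int_eq; apply: (mulfI tau0).
have -> : (N%:R * M%:R * \sum_i eps i)%:~R = N%:R * M%:R * \sum_i (eps i)%:~R :>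
    K.
  by rewrite !rmorphM /= rmorph_sum !rmorph_nat.
have sd : sdim K s = tau * \sum_i (eps i)%:~R.
  by rewrite /sdim mulr_sumr; apply: eq_bigr => i _; rewrite sE.
transitivity (c * M%:R ^+ 2); last first.
  by rewrite expr2 mulrA cM sd; ring.
rewrite /c mulrDl rmorphD /= mulrDr rmorphM /= rmorph_nat !rmorph_sum /=;
    congr (_ + _).
  rewrite mulr_sumr mulr_suml; apply: eq_bigr => i _.
  rewrite sE ffunE rmorphM rmorphXn /= exprMn exprVn -!mulrA;
      congr (_ * (_ * _)).
  by rewrite mulVf ?mulr1 // expf_neq0.
rewrite !mulr_sumr mulr_suml; apply: eq_bigr => i _.
rewrite rmorph_sum !mulr_sumr mulr_suml; apply: eq_bigr => j _.
rewrite signr_addb !sE !ffunE !(rmorphM, rmorphB) /=.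
have -> : tau * (eps i)%:~R * (tau * (eps j)%:~R) = (eps i)%:~R * (eps j)%:~R :>
    K.
  by rewrite mulrACA tau2 mul1r.
by field.
Qed.

End Facts.

(** * Arithmetic of the highest weight *)

(** The pairing of a weight of gl(n) with 2 rho. *)
Definition pairsum n (g : 'I_n -> rat) : rat :=
  \sum_(i < n) \sum_(j < n | (i < j)%N) (g i - g j).

Lemma pairsum_lin n (g h : 'I_n -> rat) c : 
  pairsum (fun i => g i + c * h i) = pairsum g + c * pairsum h.
Proof.
rewrite /pairsum mulr_sumr -big_split; apply: eq_bigr => i _ /=.
by rewrite mulr_sumr -big_split; apply: eq_bigr => j _ /=; ring.
Qed.

Lemma pairsum_first n : pairsum (fun i : 'I_n.+1 => (i == ord0)%:R) = n%:R.
Proof.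
rewrite /pairsum big_ord_recl [X in _ + X]big1 ?addr0; last first.
  move=> i _; rewrite big1 // => j ij /=.
  by rewrite -[j == ord0]val_eqE /= gtn_eqF ?subrr // (leq_ltn_trans _ ij).
rewrite big_mkcond big_ord_recl /= add0r.
by rewrite (eq_bigr (fun=> 1)) ?sumr_const ?card_ord.
Qed.

Lemma pairsum_last n : pairsum (fun i : 'I_n.+1 => (i == ord_max)%:R) = - n%:R.
Proof.
rewrite /pairsum (eq_bigr (fun i : 'I_n.+1 => - (i != ord_max)%:R)); last first.
  move=> i _; have [->|im] := eqVneq i ord_max.
    by rewrite big1 ?oppr0 // => j /=; rewrite ltnNge -ltnS ltn_ord.
  have lt_i : (i < n)%N by rewrite ltn_neqAle -ltnS ltn_ord andbT; exact: im.
  rewrite (bigD1 ord_max) //= eqxx sub0r big1 ?addr0 // => j /andP[_ /negPf->].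
  by rewrite subr0.
rewrite sumrN big_ord_recr /= eqxx addr0 (eq_bigr (fun=> 1)) ?sumr_const
    ?card_ord //.
by move=> i _; rewrite -val_eqE /= ltn_eqF.
Qed.

Lemma sum_ind n (i0 : 'I_n) : \sum_(i < n) (i == i0)%:R = 1 :> rat.
Proof. by rewrite (bigD1 i0) //= eqxx big1 ?addr0 // => i /negPf->. Qed.

(** The weights that survive are constant but for one or two units at one of
    the two ends, hence the assumption that k or l is 0. *)
Lemma shape_sums n (c k l : rat) (g : 'I_n.+1 -> rat) : k * l = 0 ->
  (forall i, g i = c + k * (i == ord0)%:R - l * (i == ord_max)%:R) ->
  [/\ \sum_i g i = n.+1%:R * c + k - l,
      \sum_i g i ^+ 2 = n.+1%:R * c ^+ 2 + 2 * c * (k - l) + k ^+ 2 + l ^+ 2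
    & pairsum g = n%:R * (k + l)].
Proof.
move=> kl gE; split.
- rewrite (eq_bigr _ (fun i _ => gE i)) sumrB big_split /= -!mulr_sumr !sum_ind.
  by rewrite sumr_const card_ord mulr_natl !mulr1.
- rewrite (eq_bigr (fun i : 'I_n.+1 => c ^+ 2 + (2 * c * k + k ^+ 2) * (i ==
    ord0)%:R
     + (l ^+ 2 - 2 * c * l) * (i == ord_max)%:R)); last first.
    by move=> i _; rewrite gE; case: (i == ord0); case: (i == ord_max);
        rewrite /= ?mulr0 ?mulr1;
       nra.
  rewrite !big_split /= -!mulr_sumr !sum_ind sumr_const card_ord -mulr_natl;
      ring.
- have -> : pairsum g = pairsum (fun i : 'I_n.+1 => (c + k * (i == ord0)%:R) +
    (- l) * (i == ord_max)%:R).
    by rewrite /pairsum; apply: eq_bigr => i _; apply: eq_bigr => j _;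
        rewrite !gE; ring.
  rewrite !pairsum_lin pairsum_first pairsum_last.
  have -> : pairsum (fun _ : 'I_n.+1 => c) = 0.
    by rewrite /pairsum big1 // => i _; rewrite big1 // => j _; rewrite subrr.
  ring.
Qed.

(** The module of sl(2, 1) with highest weight (x, x | - 2 x). *)
Lemma num_small0 (x r : rat) : 1 < r -> r = 2 * x - 2 * x ^+ 2 -> False.
Proof.
move=> r1 rE; have h : 0 <= 2 * (x - 1 / 2) ^+ 2 by rewrite mulr_ge0 ?sqr_ge0.
have : 2 * (x - 1 / 2) ^+ 2 = 2 * x ^+ 2 - 2 * x + 1 / 2 by field.
lra.
Qed.

(** The module of sl(2, 1) with highest weight (x + 1, x | - 2 x - 1). *)
Lemma num_small1 (x r : rat) : r <= 3 / 2 -> r = 2 - 2 * x ^+ 2 ->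
  0 < 2 * x + 1 -> 2 * x + 1 < 2 -> False.
Proof.
move=> r1 rE x1 x2; have : 0 < (1 / 2 - x) * (1 / 2 + x) by apply: mulr_gt0;
    lra.
have -> : (1 / 2 - x) * (1 / 2 + x) = 1 / 4 - x ^+ 2 by field.
lra.
Qed.

(** In this lemma and the next ones P + 1 and Q + 1 are the sizes of the
    blocks, A and B the sums of the a_i and of the b_f. This one excludes b_q
    = - a_p = - al: the average of the b_f is at least b_q and that of the a_i
    is at least a_p, which contradicts q < p. *)
Lemma num_last (P Q A B al : rat) : Q + 1 <= P -> 0 <= Q -> 0 < A -> A + B =
    0 ->
  (Q + 1) * - al <= B -> (P + 1) * al <= A -> False.
Proof.
move=> PQ Q0 A0 AB h1 h2.
have al0 : 0 < al.
  by rewrite -(pmulr_rgt0 _ (_ : 0 < Q + 1)); lra.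
have : 0 <= (P - Q - 1) * al by rewrite mulr_ge0; lra.
nra.
Qed.

Lemma num_two (P Q A B d k : rat) : Q + 1 <= P -> 0 <= Q -> A < 2 -> A + B =
    0 ->
  0 <= k -> k <= 1 -> A = (P + 1) * d + k -> B <= (Q + 1) * - d - 2 -> False.
Proof.
move=> PQ Q0 A2 AB k0 k1 AE Ble.
have h : 2 - k <= (P - Q) * d by nra.
have d0 : 0 < d by rewrite -(pmulr_rgt0 _ (_ : 0 < P - Q)); lra.
have : 0 <= (Q + 1) * d by rewrite mulr_ge0; lra.
nra.
Qed.

Lemma num_all (P Q A B d : rat) : Q + 1 <= P -> 1 <= Q -> A < 2 -> A + B = 0 ->
  A = (P + 1) * d - 1 -> B = (Q + 1) * (- d - 1) -> False.
Proof.
move=> PQ Q1 A2 AB AE BE.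
have h : (P - Q) * d = Q + 2 by nra.
have d0 : 0 < d by rewrite -(pmulr_rgt0 _ (_ : 0 < P - Q)); lra.
have : 0 <= (Q - 1) * (d + 1) by rewrite mulr_ge0; lra.
nra.
Qed.

(** The dual of the natural module: the scalar is p - q - d with d > 0. *)
Lemma num_dual (P Q A B d r : rat) : Q + 1 <= P -> 1 < r -> A + B = 0 ->
  A = (P + 1) * d -> B = (Q + 1) * - d - 1 ->
  (P + 1) * d ^+ 2 - ((Q + 1) * d ^+ 2 + 2 * d + 1) - Q + (P - Q) * A =
      r * (P - Q) -> False.
Proof.
move=> PQ r1 AB AE BE cs.
have h : (P - Q) * d = 1 by nra.
have d0 : 0 < d by rewrite -(pmulr_rgt0 _ (_ : 0 < P - Q)); lra.
have : 0 < (r - 1) * (P - Q) by rewrite mulr_gt0; lra.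
have e : (P - Q) * A = P + 1 by rewrite AE mulrCA h mulr1.
have e2 : (P + 1) * d ^+ 2 - (Q + 1) * d ^+ 2 = d by rewrite -mulrBl expr2
    mulrA -[RHS]mul1r -h; ring.
lra.
Qed.

(** The adjoint module: the scalar is 2 (p - q). *)
Lemma num_adjoint (P Q A B d r : rat) : Q + 1 <= P -> r <= 3 / 2 -> A + B = 0 ->
  A = (P + 1) * d + 1 -> B = (Q + 1) * - d - 1 ->
  (P + 1) * d ^+ 2 + 2 * d + 1 - ((Q + 1) * d ^+ 2 + 2 * d + 1) + P - Q +
      (P - Q) * A
    = r * (P - Q) -> False.
Proof.
move=> PQ r1 AB AE BE cs.
have : (P - Q) * d == 0 by apply/eqP; nra.
rewrite mulf_eq0 => /orP[/eqP|/eqP d0]; first by lra.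
have : 0 < (2 - r) * (P - Q) by rewrite mulr_gt0; lra.
move: cs; rewrite AE d0; lra.
Qed.

(** The highest weight (d, ..., d, d - 1 | - d - 1): the scalar is 2 (P + 1) -
    2 d. It occurs in the tensor square of the dual of the natural module. *)
Lemma num_square (P Q A B d r : rat) : Q = 0 -> 1 <= P -> r <= 3 / 2 -> d < 1 ->
  A + B = 0 -> A = (P + 1) * d - 1 -> B = (Q + 1) * (1 - d) - 2 ->
  (P + 1) * d ^+ 2 - 2 * d + 1 - ((Q + 1) * (1 - d) ^+ 2 - 4 * (1 - d) + 4)
    + P - 2 * Q + (P - Q) * A = r * (P - Q) -> False.
Proof.
move=> -> P1 r1 d1 AB AE BE cs.
have h : P * d = 2 by lra.
have : 0 <= (3 / 2 - r) * P by rewrite mulr_ge0; lra.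
have e1 : (P + 1) * d ^+ 2 - 2 * d + 1 - ((0 + 1) * (1 - d) ^+ 2 - 4 * (1 - d) +
    4)
    = - 2 * d.
  have -> : (P + 1) * d ^+ 2 - 2 * d + 1 - ((0 + 1) * (1 - d) ^+
      2 - 4 * (1 - d) + 4)
    = (P * d) * d - 4 * d by ring.
  by rewrite h; ring.
have e2 : P * A = P + 2.
  have -> : P * A = (P * d) * P + P * d - P by rewrite AE; ring.
  by rewrite h; ring.
lra.
Qed.

Lemma num_exc (P Q A B d : rat) : P = 2 -> Q = 1 -> d < 1 -> A + B = 0 ->
  A = (P + 1) * d - 1 -> B <= (Q + 1) * (1 - d) - 2 -> False.
Proof. by move=> -> -> *; lra. Qed.

(** The left side is the Casimir scalar of the highest weight (a | b), for
    coordinates that add up to 0. *)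
Definition casimir_eq p q (a : 'I_p.+1 -> rat) (b : 'I_q.+1 -> rat) (r : rat) :=
  \sum_i a i ^+ 2 - \sum_f b f ^+ 2 + pairsum a - pairsum b
    + (p%:R - q%:R) * (\sum_i a i) = r * (p%:R - q%:R).

Section Arith.
Variables (p q : nat) (a : 'I_p.+1 -> rat) (b : 'I_q.+1 -> rat) (r : rat).
Variable A : rat.
Hypothesis AE : A = \sum_i a i.
Hypotheses (qp : (q < p)%N) (r_gt : 1 < r) (r_le : r <= 3 / 2).
Hypothesis sum0 : A + \sum_f b f = 0.
Hypotheses (A_gt : 0 < A) (A_lt : A < 2).
Hypothesis b_gt : forall f, - 2 < b f.
Hypothesis a_dom : forall i j : 'I_p.+1, (i < j)%N ->
  [\/ a i - a j = 0, a i - a j = 1 | a i - a j = 2].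
Hypothesis b_dom : forall f g : 'I_q.+1, (f < g)%N -> b g <= b f.
Hypothesis triple : forall (i j k : 'I_p.+1) f, (i < j)%N -> (j < k)%N ->
  [\/ a k + b f = 0, a j + b f + 1 = 0 | a i + b f + 2 = 0].
Hypothesis step : forall (i k : 'I_p.+1) f, (i < k)%N -> a k + b f != 0 ->
  a i - a k = 0 \/ a i - a k = 1.

Lemma a_le (i j : 'I_p.+1) : (i <= j)%N -> a j <= a i.
Proof.
rewrite leq_eqVlt => /orP[/eqP/val_inj-> //|/a_dom ij].
by case: ij => h; lra.
Qed.

Lemma b_le (i j : 'I_q.+1) : (i <= j)%N -> b j <= b i.
Proof. by rewrite leq_eqVlt => /orP[/eqP/val_inj-> //|/b_dom]. Qed.

Let pq : (q%:R : rat) + 1 <= p%:R.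
Proof. by rewrite natr1 ler_nat. Qed.

Let q0 : 0 <= (q%:R : rat). Proof. exact: ler0n. Qed.

(** The sign conditions exclude a_2 + b_1 = 0, so a_1 - a_2 is 0 or 1; as the
    coordinates add up to 0, one parameter is left in either case. *)
Lemma no_weight_two : casimir_eq a b r -> p = 1%N -> False.
Proof.
move=> cas p1; have q00 : q = 0%N by lia.
pose k : rat := a ord0 - a ord_max; pose c : rat := a ord_max.
have aE i : a i = c + k * (i == ord0)%:R - 0 * (i == ord_max)%:R.
  have [->|i0] := eqVneq i ord0; first by rewrite mulr1 mul0r /k /c; ring.
  have -> : i = ord_max.
    apply: val_inj; move: i0; rewrite -val_eqE /=; have := ltn_ord i; lia.
  by rewrite mulr0 mul0r /c; ring.
have bE f : b f = b ord0 + 0 * (f == ord0)%:R - 0 * (f == ord_max)%:R.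
  have -> : f = ord0 by apply: val_inj => /=; have := ltn_ord f; lia.
  by rewrite !mul0r; ring.
have [aS aQ aP] := shape_sums (mulr0 _) aE; have [bS bQ bP] :=
    shape_sums (mul0r _) bE.
have k_dom : [\/ k = 0, k = 1 | k = 2] by apply: a_dom; rewrite /= p1.
have st : c + b ord0 != 0 -> k = 0 \/ k = 1 by apply: step; rewrite /= p1.
move: cas; rewrite /casimir_eq aQ bQ aP bP; move: sum0 A_gt A_lt.
rewrite bS AE aS; move: (b ord0) st => w.
move: k k_dom {aE bE aS aQ aP bS bQ bP}; move: c => x k k_dom; rewrite p1 q00
    {p1 q00} => st.
move=> s0 Ag Al.
have wE : w = - (2 * x + k) by lra.
have xw : x + w != 0.
  by apply/eqP => e; case: k_dom => ke; lra.
move: s0 Ag Al; rewrite wE; case: (st xw) => -> s0 Ag Al cs.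
  have rE : r = 2 * x - 2 * x ^+ 2 by rewrite -[r]mulr1 -{1}[1]subr0 -cs; ring.
  exact: num_small0 r_gt rE.
have rE : r = 2 - 2 * x ^+ 2 by rewrite -[r]mulr1 -{1}[1]subr0 -cs; ring.
by apply: (num_small1 r_le rE); lra.
Qed.

(** Every b_f is either - d - 1, where d is the common value of the middle
    coordinates of a, or - a_p. The last one is of the first kind by
    [num_last]. If a second one is, then the sum of the b_f is too negative
    for the bounds on the a_i. Otherwise a and b are constant up to their end
    coordinates, and the Casimir identity decides. *)
Lemma no_weight_many : casimir_eq a b r -> (2 <= p)%N -> False.
Proof.
move=> cas p2; pose fl : 'I_q.+1 := ord_max; pose i1 : 'I_p.+1 := inord 1.
have i1B : i1 == 1%N :> nat by rewrite inordK // ltnS ltnW.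
have A_le : A <= p.+1%:R * a ord0.
  rewrite AE; by rewrite mulr_natl -[p.+1 in leRHS]card_ord -sumr_const; apply:
      ler_sum => i _; apply: a_le.
have A_ge : p.+1%:R * a ord_max <= A.
  rewrite AE mulr_natl -[p.+1 in leLHS]card_ord -sumr_const; apply: ler_sum =>
      i _.
  by apply: a_le; rewrite -ltnS ltn_ord.
have p1_gt0 : 0 < (p.+1%:R : rat) by rewrite ltr0n.
have a0_gt0 : 0 < a ord0 by rewrite -(pmulr_rgt0 _ p1_gt0); apply:
    lt_le_trans A_le.
have types f : (forall k : 'I_p.+1, (2 <= k)%N -> a k = - b f) \/
    (forall j : 'I_p.+1, (0 < j)%N -> (j < p)%N -> a j = - b f - 1).
  have [e|ne] := eqVneq (a ord_max + b f) 0; [left | right].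
    move=> k k2; have k1 : (i1 < k)%N by rewrite (eqP i1B).
    have [||h|h|h] := @triple ord0 i1 k f; rewrite ?(eqP i1B) //; first by lra.
      have := @a_le i1 ord_max; rewrite (eqP i1B) /= => /(_ _);
          move/(_ (ltnW p2)); lra.
    by have := b_gt f; lra.
  move=> j j0 jp; have [||h|h|h] := @triple ord0 j ord_max f => //.
  - by rewrite h eqxx in ne.
  - by lra.
  - by have := b_gt f; lra.
have [flast|flast] := types fl.
  have al := flast ord_max p2.
  have b_ge : q.+1%:R * b fl <= \sum_f b f.
    rewrite mulr_natl -[q.+1 in leLHS]card_ord -sumr_const; apply: ler_sum =>
        f _.
    by apply: b_le; rewrite -ltnS ltn_ord.
  apply: (num_last pq q0 A_gt sum0 (al := a ord_max)); last by rewrite natr1.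
  by rewrite natr1 al opprK.
set d := - b fl - 1 in flast.
have d_lt : d < 1 by have := b_gt fl; rewrite /d; lra.
have a1 : a i1 = d by apply: flast; rewrite (eqP i1B).
have al_le : a ord_max <= d by rewrite -a1; apply: a_le; rewrite (eqP i1B);
    exact: ltnW p2.
have a0_dom := @a_dom ord0 i1; rewrite (eqP i1B) a1 in a0_dom.
have a0_st : a ord0 - a ord_max = 0 \/ a ord0 - a ord_max = 1.
  apply: (@step _ _ fl); first exact: ltnW p2.
  by apply/eqP => e; rewrite /d in al_le; lra.
pose k := a ord0 - d; pose l := d - a ord_max.
have aE i : a i = d + k * (i == ord0)%:R - l * (i == ord_max)%:R.
  have [->|i0] := eqVneq i ord0.
    rewrite (_ : (ord0 == ord_max :> 'I_p.+1) = false) ?mulr0 ?mulr1;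
        last first.
      by rewrite -val_eqE /= ltn_eqF // ltnW.
    by rewrite /k; ring.
  have [->|im] := eqVneq i ord_max; first by rewrite mulr0 mulr1 /l; ring.
  rewrite !mulr0 addr0 subr0; apply: flast; first by rewrite lt0n; exact: i0.
  by rewrite ltn_neqAle -ltnS ltn_ord andbT; exact: im.
have kl : (k, l) \in [:: (0, 0); (1, 0); (0, 1)].
  rewrite !inE !xpair_eqE /k /l; case: (a0_dom isT) => e1; case: a0_st => e2.
  - by apply/or3P/Or31/andP; split; apply/eqP; lra.
  - by apply/or3P/Or33/andP; split; apply/eqP; lra.
  - by exfalso; lra.
  - by apply/or3P/Or32/andP; split; apply/eqP; lra.
  - by exfalso; lra.
  - by exfalso; lra.
have klE : k * l = 0.
  by move: kl; rewrite !inE !xpair_eqE => /or3P[]/andP[/eqP-> /eqP->];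
    rewrite ?mul0r ?mulr0.
move: k l aE kl klE => k l aE kl klE.
have [aS aQ aP] := shape_sums klE aE; rewrite -AE in aS.
have alE : a ord_max = d - l.
  rewrite aE eqxx (_ : (ord_max == ord0 :> 'I_p.+1) = false); first by rewrite
      mulr0 mulr1 addr0.
  by rewrite -val_eqE /= gtn_eqF // ltnW.
have bE f : b f = - d - 1 \/ (b f = l - d /\ (l = 1 -> p = 2%N)).
  have [h|h] := types f; [right | left].
    split; first by have := h ord_max p2; rewrite alE; lra.
    move=> l1; apply/eqP; rewrite eqn_leq p2 andbT leqNgt; apply/negP => p3.
    have i2B : (inord 2 : 'I_p.+1) == 2%N :> nat by rewrite inordK // ltnS.
    have := h (inord 2); rewrite (eqP i2B) flast ?(eqP i2B) // => /(_ isT).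
    by have := h ord_max p2; rewrite alE l1; lra.
  by have := h i1; rewrite (eqP i1B) a1 => /(_ isT p2); lra.
have l0 : 0 <= l by move: kl; rewrite !inE !xpair_eqE => /or3P[]/andP[_ /eqP->].
have b_up f : b f <= l - d by case: (bE f) => [->|[-> _]]; lra.
have bfl : b fl = - d - 1 by rewrite /d; lra.
case: (boolP [exists f, (f != fl) && (b f == - d - 1)]) =>
    [/existsP[f1 /andP[f1l /eqP bf1]]|].
  have bS : \sum_f b f <= q.+1%:R * (l - d) - 2 * (1 + l).
    rewrite (bigD1 fl) //= (bigD1 f1) //= bfl bf1.
    have le : \sum_(f | (f != fl) && (f != f1)) b f <=
              \sum_(f < q.+1 | (f != fl) && (f != f1)) (l - d).
      by apply: ler_sum => f _; apply: b_up.
    have eq : q.+1%:R * (l - d) = (l - d) + ((l - d) +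
        \sum_(f < q.+1 | (f != fl) && (f != f1)) (l - d)).
      rewrite mulr_natl -[q.+1 in LHS]card_ord -sumr_const (bigD1 fl) //=.
      by rewrite [in LHS](bigD1 f1).
    by rewrite eq; lra.
  have q1 : (0 < q)%N.
    rewrite lt0n; apply: contraNneq f1l => q00; rewrite -val_eqE /=.
    by rewrite eqn_leq -ltnS ltn_ord (leq_trans (eq_leq q00)).
  have q1r : 1 <= (q%:R : rat) by rewrite ler1n.
  move: kl; rewrite !inE !xpair_eqE => /or3P[]/andP[/eqP k0 /eqP l00];
      subst k l.
  - apply: (num_two pq q0 A_lt sum0 (d := d) (k := 0)) => //.
      by rewrite natr1; lra.
    by move: bS; rewrite -natr1; lra.
  - apply: (num_two pq q0 A_lt sum0 (d := d) (k := 1)) => //.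
      by rewrite natr1; lra.
    by move: bS; rewrite -natr1; lra.
  case: (boolP [forall f, b f == - d - 1]) => [/forallP ball|].
    apply: (num_all pq q1r A_lt sum0 (d := d)); first by rewrite natr1; lra.
    rewrite (eq_bigr (fun=> - d - 1)) => [|f _]; last exact/eqP.
    by rewrite sumr_const card_ord natr1 mulr_natl.
  move=> /forallPn[f2 /eqP bf2]; have [//|[_ /(_ erefl) p2']] := bE f2.
  have q1' : q = 1%N by apply/eqP; rewrite eqn_leq -ltnS -p2' qp.
  apply: (num_exc (P := p%:R) (Q := q%:R) (d := d) _ _ d_lt sum0);
      rewrite ?natr1.
  - by rewrite p2'.
  - by rewrite q1'.
  - by rewrite aS addr0.
  - by clear p2' q1'; lra.
move=> /existsPn nof.
have bshape f : b f = (l - d) + 0 * (f == ord0)%:R - (1 + l) * (f ==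
    ord_max)%:R.
  have [->|ne] := eqVneq f ord_max; first by rewrite -/fl bfl mul0r mulr1; ring.
  have := nof f; rewrite ne /= => /eqP nf; have [//|[-> _]] := bE f.
  by rewrite mul0r mulr0; ring.
have [bS bQ bP] := shape_sums (mul0r _) bshape.
move: cas; rewrite /casimir_eq -AE aQ bQ aP bP => cs.
move: kl; rewrite !inE !xpair_eqE => /or3P[]/andP[/eqP k0 /eqP l00]; subst k l.
- apply: (num_dual pq r_gt sum0 (d := d)); rewrite ?natr1; first by lra.
    by move: bS; lra.
  by rewrite -cs; ring.
- apply: (num_adjoint pq r_le sum0 (d := d)); rewrite ?natr1; first by lra.
    by move: bS; lra.
  by rewrite -cs; ring.
have [q00|q1] := posnP q; last first.
  have f0 : (ord0 : 'I_q.+1) != fl by rewrite -val_eqE /= neq_ltn q1.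
  have [e|[_ /(_ erefl) p2']] := bE ord0; first by have := nof ord0;
      rewrite f0 e eqxx.
  have q1' : q = 1%N by apply/eqP; rewrite eqn_leq -ltnS -p2' qp.
  apply: (num_exc (P := p%:R) (Q := q%:R) (d := d) _ _ d_lt sum0);
      rewrite ?natr1.
  - by rewrite p2'.
  - by rewrite q1'.
  - by rewrite aS addr0.
  - by clear p2' q1'; lra.
have P1 : 1 <= (p%:R : rat) by rewrite ler1n ltnW.
apply: (num_square (Q := q%:R) (P := p%:R) _ P1 r_le d_lt sum0); rewrite ?natr1.
- by rewrite q00.
- by rewrite aS addr0.
- by rewrite bS; ring.
- by rewrite -cs; ring.
Qed.

End Arith.

(** * Two blocks of different sizes *)

Section NoAction.
Variables (K : closedFieldType) (N : nat) (F : filippovSuperalgebra K N).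
Variables (p q : nat) (t : bool).
Local Notation T := ('I_p.+1 + 'I_q.+1)%type.
Variable E : T -> T -> 'End(F).
Definition in_first (x : T) : bool := if x is inl _ then true else false.
(** The larger block comes first. *)
Definition block_order (x : T) : nat := match x with inl i => i | inr f =>
    p.+1 + f end.
Hypothesis act : mxaction (fun x => if in_first x then t else ~~ t) E.
Hypothesis K0 : [pchar K] =i pred0.
Hypothesis simF : fsimple F.
Hypothesis F0 : homog F false <> 0%VS.
Hypothesis N2 : (2 < N)%N.
Hypothesis qp : (q < p)%N.

Lemma block_order_inj : injective block_order.
Proof.
move=> [i|f] [j|g] /= e.
- by congr inl; apply: val_inj.
- by have := ltn_ord i; rewrite e -ltn_subRL subnn.
- by have := ltn_ord j; rewrite -e -ltn_subRL subnn.
- by congr inr; apply: val_inj; apply/eqP; rewrite -(eqn_add2l p.+1) e.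
Qed.

(** Division by N - 1 turns [highest_facts] into the hypotheses of
    [no_weight_two] and [no_weight_many]. *)
Lemma no_gl_action : False.
Proof.
have ab : (inl ord0 : T) != inr ord0 by [].
have ordP (i j : T) : in_first i -> ~~ in_first j ->
    (block_order i < block_order j)%N.
  by case: i j => [i|//] [//|f] _ _ /=; rewrite ltn_addr.
have [z [zs zA zb zdom [ztr zst zcas]]] := highest_facts act K0 simF F0 N2 ab
  block_order_inj (fun=> erefl) ordP (isT : in_first (inl ord0))
      (isT : ~~ in_first (inr ord0)).
pose mu : rat := N.-1%:R.
have mu0 : 0 < mu by rewrite ltr0n; case: N N2 => [|[|]].
pose a i : rat := (z (inl i))%:~R / mu; pose b f : rat := (z (inr f))%:~R / mu.
pose v (x : T) : rat := (z x)%:~R / mu.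
have vE x : (z x)%:~R = mu * v x by rewrite mulrC divfK // gt_eqF.
have mui (x y : rat) : mu * x = mu * y -> x = y by apply: mulfI; rewrite gt_eqF.
have muE : (N.-1%:R : int)%:~R = mu by rewrite rmorph_nat.
have sumE (f : T -> rat) : \sum_x f x = \sum_i f (inl i) + \sum_g f (inr g).
  by rewrite big_sumType.
have dom i j : (block_order i < block_order j)%N -> in_first i = in_first j ->
    [\/ v i - v j = 0, v i - v j = 1 | v i - v j = 2].
  move=> ij e; case: (zdom i j ij e) => /(congr1 (intr : int -> rat));
    rewrite rmorphB /= ?rmorphMn /= ?muE !vE -mulrBr => h;
    [apply: Or31 | apply: Or32 | apply: Or33]; apply: mui; rewrite h ?mulr0
        ?mulr1 //.
  by rewrite mulr_natr.
have muN : N%:R = mu + 1 :> rat by rewrite natr1 prednK // (ltn_trans _ N2).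
have mu2 : 2 <= mu by rewrite (ler_nat _ 2) -ltnS prednK // (ltn_trans _ N2).
have r_gt : 1 < N%:R / mu by rewrite ltr_pdivlMr // muN; lra.
have r_le : N%:R / mu <= 3 / 2 by rewrite ler_pdivrMr // muN; lra.
have sum0 : \sum_i a i + \sum_f b f = 0.
  rewrite -(sumE v); apply: mui; rewrite mulr0 mulr_sumr.
  rewrite (eq_bigr (fun x => (z x)%:~R)) => [|x _]; last by rewrite vE.
  by rewrite -rmorph_sum /= zs.
pose e (x : T) : rat := (-1) ^+ (~~ in_first x).
have zq : \sum_x e x * v x ^+ 2 +
    \sum_x \sum_(y | (block_order x < block_order y)%N)
     e y * (v x - e x * e y * v y) = N%:R / mu * \sum_x e x.
  apply: (mui); apply: mui; move/(congr1 (intr : int -> rat)): zcas.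
  rewrite rmorphD !rmorphM /= !rmorph_sum /= muE => h.
  have -> : mu * (mu * (N%:R / mu * \sum_x e x)) = N%:R * mu * \sum_x e x.
    by field; rewrite gt_eqF.
  have <- : (N%:R : int)%:~R * mu * \sum_x ((-1) ^+ (~~ in_first x) : int)%:~R =
     N%:R * mu * \sum_x e x.
    rewrite rmorph_nat; congr (_ * _); apply: eq_bigr => x _; exact:
        rmorph_sign.
  rewrite -h mulrA mulrDr; congr (_ + _).
    rewrite mulr_sumr; apply: eq_bigr => x _.
    by rewrite rmorphM rmorph_sign rmorphXn /= vE /e; ring.
  rewrite -mulrA; congr (_ * _); rewrite mulr_sumr; apply: eq_bigr => x _.
  rewrite mulr_sumr rmorph_sum; apply: eq_bigr => y _ /=.
  by rewrite rmorphM rmorphB !rmorphM /= !rmorph_sign !vE /e; ring.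
have cas : casimir_eq a b (N%:R / mu).
  rewrite /casimir_eq; move: zq; rewrite !sumE /e /=.
  have -> : \sum_(i < p.+1) (-1) ^+ false + \sum_(f < q.+1) (-1) ^+ true =
      p%:R - q%:R :> rat.
    by rewrite !sumr_const !card_ord -!natr1; ring.
  move=> <-; rewrite -!addrA; congr (_ + _).
    by apply: eq_bigr => i _; rewrite mul1r.
  congr (_ + _); first by rewrite -sumrN; apply: eq_bigr => f _; rewrite mulN1r.
  rewrite [X in _ = X + _](eq_bigr (fun i : 'I_p.+1 =>
     \sum_(j < p.+1 | (i < j)%N) (a i - a j) + - \sum_(f < q.+1) (a i + b f)));
         last first.
    move=> i _; rewrite big_sumType /=; congr (_ + _).
      by apply: eq_bigr => j _; rewrite expr0 !mul1r.
    rewrite -sumrN; apply: eq_big => [f|f _]; first by rewrite ltn_addr.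
    by rewrite expr0 expr1 mul1r !mulN1r opprK.
  rewrite [in RHS]big_split /= -/(pairsum a) -addrA; congr (_ + _).
  rewrite [LHS]addrC; congr (_ + _).
    rewrite sumrN.
    have -> : \sum_(i < p.+1) \sum_(f < q.+1) (a i + b f) =
        (q%:R + 1) * \sum_i a i + (p%:R + 1) * \sum_f b f.
      rewrite (eq_bigr (fun i => (q%:R + 1) * a i + \sum_f b f)) => [|i _];
          last first.
        by rewrite big_split /= sumr_const card_ord natr1 mulr_natl.
      by rewrite big_split /= -mulr_sumr sumr_const card_ord !natr1 !mulr_natl.
    have -> : \sum_f b f = - \sum_i a i by apply/eqP; rewrite -addr_eq0 addrC
        sum0.
    ring.
  rewrite -sumrN; apply: eq_bigr => f _; rewrite big_sumType /=
      [X in X + _]big_pred0 ?add0r.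
    rewrite -sumrN; apply: eq_big => [g|g _]; first by rewrite ltn_add2l.
    by rewrite expr1 mulrNN mulN1r !mul1r.
  by move=> j; rewrite ltnNge (leq_trans (ltnW (ltn_ord j))) // leq_addr.
have AE : mu * \sum_i a i = (level (fun i => (in_first i)%:R) z)%:~R.
  rewrite /level rmorph_sum /= big_sumType /= [X in _ + X]big1 ?addr0;
      last first.
    by move=> f _; rewrite mul0r.
  by rewrite mulr_sumr; apply: eq_bigr => i _; rewrite mul1r -vE.
have /andP[A_gt A_lt] : 0 < \sum_i a i < 2.
  case/andP: zA; rewrite -[0 < _](ltr_int rat) -AE mulr0z pmulr_rgt0 // => ->.
  rewrite -(ltr_int rat) -AE rmorphMn /= muE mulr2n -[X in _ < X +
      X]mulr1 -mulrDr.
  by rewrite ltr_pM2l.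
have b_gt f : - 2 < b f.
  have := zb (inr f) isT; rewrite -(ltr_int rat) vE rmorphN rmorphMn /= muE.
  by rewrite -mulr_natr -mulrN ltr_pM2l.
have st (i k : 'I_p.+1) f : (i < k)%N -> a k + b f != 0 -> a i - a k = 0 \/
    a i - a k = 1.
  move=> ik nz; have [|h|h|h] := zst (inl i) (inl k) (inr f) isT isT ik.
  - apply: contraNneq nz => /(congr1 (intr : int -> rat)) h; apply/eqP/mui.
    by rewrite mulrDr -!vE -rmorphD /= h mulr0.
  - have : 0 < (N.-1%:R : int) by rewrite ltr0n; case: N N2 => [|[|]].
    by case: (zdom (inl i) (inl k) ik erefl) => h1; rewrite h1 in h; lia.
  - by left; apply: mui; rewrite mulr0 mulrBr -!vE -rmorphB /= h ?muE.
  - by right; apply: mui; rewrite mulr1 mulrBr -!vE -rmorphB /= h ?muE.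
have tr (i j k : 'I_p.+1) f : (i < j)%N -> (j < k)%N ->
    [\/ a k + b f = 0, a j + b f + 1 = 0 | a i + b f + 2 = 0].
  move=> ij jk; case: (ztr (inl i) (inl j) (inl k) (inr f)) =>
      // /(congr1 (intr : int -> rat));
    rewrite !rmorphD /= ?rmorphMn /= ?muE !vE -!mulrDr => h.
  - by apply: Or31; apply: mui; rewrite mulr0.
  - by apply: Or32; apply: mui; rewrite mulr0 -[RHS]h /v /a /b; ring.
  - by apply: Or33; apply: mui; rewrite mulr0 -[RHS]h /v /a /b; ring.
have a_dom (i j : 'I_p.+1) : (i < j)%N -> [\/ a i - a j = 0, a i - a j =
    1 | a i - a j = 2].
  by move=> ij; apply: (dom (inl i) (inl j)).
have b_dom (f g : 'I_q.+1) : (f < g)%N -> b g <= b f.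
  move=> fg; rewrite -subr_ge0; have [||->|->|->] // := dom (inr f) (inr g).
  by rewrite /= ltn_add2l.
have [p2|p1] := leqP 2 p.
  exact: (no_weight_many erefl qp r_gt r_le sum0 A_gt A_lt b_gt a_dom b_dom tr
      st cas).
apply: (no_weight_two erefl qp r_gt r_le sum0 A_gt A_lt a_dom st cas).
by apply/eqP; rewrite eqn_leq -ltnS p1 (leq_ltn_trans _ qp).
Qed.

End NoAction.

(** * The matrix units in the case of sl(m + 1, n + 1) *)

Lemma mxaction_reindex (K : fieldType) (N : nat) (F : filippovSuperalgebra K N)
    (T T' : finType) (s : T -> bool) (s' : T' -> bool) (E : T -> T -> 'End(F))
    (h : T' -> T) : bijective h -> (forall x, s (h x) = s' x) ->
  mxaction s E -> mxaction s' (fun x y => E (h x) (h y)).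
Proof.
move=> bij_h ss' act; have inj_h := bij_inj bij_h; split.
- by move=> i j; rewrite -!ss'; apply: (act_homog act).
- by move=> i j a b v; rewrite (act_comm act) !(inj_eq inj_h) !ss'.
- move=> v; rewrite -[RHS](act_trace act v) [RHS](reindex h) //=.
  exact: onW_bij.
- by move=> i j; apply: (act_inder act).
- move=> f /(act_ad act)[c ->]; exists (fun x y => c (h x) (h y)).
  rewrite (reindex h) /=; last exact: onW_bij.
  apply: eq_bigr => i _; rewrite (reindex h) //=; exact: onW_bij.
- by move=> i j ij; apply: (act_inj act); rewrite (inj_eq inj_h).
Qed.

Section SlAction.
Variables (K : fieldType) (m n N : nat) (F : filippovSuperalgebra K N).
Local Notation M := 'M[K]_(m.+1 + n.+1).
Local Notation R := 'I_(m.+1 + n.+1).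
Hypothesis K0 : [pchar K] =i pred0.
Hypothesis neq_mn : m <> n.

Definition row_parity (i : R) : bool := if split i is inl _ then false else
    true.

Lemma mxpartE d (X : M) i j :
  mxpart d X i j = if row_parity i (+) row_parity j == d then X i j else 0.
Proof.
have sl i' : split (lshift n.+1 i') = inl i' :> 'I_m.+1 + 'I_n.+1 :=
    unsplitK (inl i').
have sr j' : split (rshift m.+1 j') = inr j' :> 'I_m.+1 + 'I_n.+1 :=
    unsplitK (inr j').
rewrite /mxpart /row_parity.
case: (split_ordP i) => i' ->; case: (split_ordP j) => j' ->; rewrite ?sl ?sr;
  by case: d; rewrite /= ?block_mxEul ?block_mxEur ?block_mxEdl ?block_mxEdr
      ?mxE.
Qed.

Lemma mxpart_delta i j : mxpart (~~ (row_parity i (+) row_parity j))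
    (delta_mx i j : M) = 0.
Proof.
apply/matrixP => a b; rewrite mxpartE !mxE.
case: (eqVneq a i) => [->|]; case: (eqVneq b j) => [->|]; rewrite ?andbF
    ?if_same //=.
by case: (_ (+) _).
Qed.

Lemma mxpart_scalar (c : K) : mxpart true (c%:M : M) = 0.
Proof.
apply/matrixP => a b; rewrite mxpartE !mxE.
by case: (eqVneq a b) => [->|_]; rewrite ?addbb //= if_same.
Qed.

Lemma supertrace_odd (X : M) : mxpart false X = 0 -> supertrace X = 0.
Proof.
move=> X0; rewrite -[X]mxpart_add X0 add0r /supertrace /mxpart block_mxKul
    block_mxKdr.
by rewrite !mxtrace0 subrr.
Qed.

Definition sl_sdim : K := m.+1%:R - n.+1%:R.

Lemma sl_sdim_neq0 : sl_sdim != 0.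
Proof.
rewrite /sl_sdim subr_eq0; have := K0 => /pcharf0P K0P.
have key a b : (a < b)%N -> a%:R != b%:R :> K.
  by move=> ab; rewrite eq_sym -subr_eq0 -natrB ?(ltnW ab) // K0P -lt0n
      subn_gt0.
case: (ltngtP m n) => [lt|lt|//]; first exact: key.
by rewrite eq_sym; apply: key.
Qed.

Lemma supertrace1 : supertrace (1%:M : M) = sl_sdim.
Proof.
by rewrite /supertrace scalar_mx_block block_mxKul block_mxKdr !mxtrace_scalar.
Qed.

(** The projection of gl onto sl along the scalar matrices, which makes the
    identity matrix act as 0. *)
Definition slproj (X : M) : M := X - (supertrace X / sl_sdim)%:M.

Lemma supertrace_scalar (c : K) : supertrace (c%:M : M) = c * sl_sdim.
Proof.
by rewrite -[c%:M]scalemx1 linearZ /= supertrace1.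
Qed.

Lemma slproj_sl X : slproj X \in slv K m n.
Proof.
rewrite memv_ker lfunE /= /slproj linearB /= supertrace_scalar divfK
    ?sl_sdim_neq0 //.
by rewrite subrr.
Qed.

Lemma slproj_id X : supertrace X = 0 -> slproj X = X.
Proof. by move=> X0; rewrite /slproj X0 mul0r raddf0 subr0. Qed.

Lemma slproj_is_linear : linear slproj.
Proof.
move=> c X Y; rewrite /slproj.
have -> : supertrace (c *: X + Y) = c * supertrace X + supertrace Y.
  exact: supertrace_is_linear.
rewrite mulrDl raddfD /= opprD addrACA scalerBr scale_scalar_mx.
by rewrite -mulrA.
Qed.
HB.instance Definition _ := GRing.isLinear.Build K M M _ slproj
    slproj_is_linear.

Lemma slproj_part i j : mxpart (~~ (row_parity i (+) row_parity j))
    (slproj (delta_mx i j)) = 0.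
Proof.
rewrite /slproj linearB /= mxpart_delta sub0r.
case e : (row_parity i (+) row_parity j); last by rewrite mxpart_scalar oppr0.
by rewrite supertrace_odd ?mul0r ?raddf0 ?oppr0 // -(mxpart_delta i j) e.
Qed.

Lemma scomm_slproj i j a b :
  scomm (slproj (delta_mx i j)) (slproj (delta_mx a b)) =
  (j == a)%:R *: delta_mx i b
  - (-1) ^+ ((row_parity i (+) row_parity j) && (row_parity a (+) row_parity b))
      *: ((i == b)%:R *: delta_mx a j) :> M.
Proof.
rewrite (scommE (slproj_part i j) (slproj_part a b)) mulnb.
have dd (x y z w : R) : delta_mx x y *m delta_mx z w = (y == z)%:R *:
    delta_mx x w :> M.
  have [->|ne] := eqVneq y z; first by rewrite mul_delta_mx scale1r.
  by rewrite mul_delta_mx_0 // scale0r.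
rewrite -(dd i j a b) [i == b]eq_sym -(dd a b i j).
have odd0 x y : row_parity x (+) row_parity y -> slproj (delta_mx x y) =
    delta_mx x y.
  by move=> e; rewrite slproj_id // supertrace_odd // -(mxpart_delta x y) e.
have shift c c' (X Y : M) : (X - c%:M) *m (Y - c'%:M) - (Y - c'%:M) *m
    (X - c%:M)
    = X *m Y - Y *m X.
  rewrite !mulmxBl !mulmxBr !mul_scalar_mx !mul_mx_scalar.
  rewrite !scale_scalar_mx [c' * c]mulrC.
  move: (X *m Y) (Y *m X) (c *: Y) (c' *: X) (c * c')%:M => P Q A B S.
  by apply/matrixP => u w; rewrite !mxE; ring.
case e1 : (row_parity i (+) row_parity j); case e2 :
    (row_parity a (+) row_parity b).
- by rewrite !odd0 ?e1 ?e2.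
- by rewrite /= !expr0 !scale1r shift.
- by rewrite /= !expr0 !scale1r shift.
- by rewrite /= !expr0 !scale1r shift.
Qed.

Definition gl_to_sl (X : M) : slA K m n := vsproj (slv K m n) (slproj X).

Lemma vsval_gl_to_sl X : vsval (gl_to_sl X : subvs_of (slv K m n)) = slproj X.
Proof. by rewrite vsprojK // slproj_sl. Qed.

Lemma gl_to_sl_is_linear : linear gl_to_sl.
Proof. by move=> c X Y; rewrite /gl_to_sl !linearP. Qed.
HB.instance Definition _ := GRing.isLinear.Build K M (slA K m n) _ gl_to_sl
    gl_to_sl_is_linear.

Lemma gl_to_sl_homog i j : gl_to_sl (delta_mx i j) \in homog (slA K m n)
    (row_parity i (+) row_parity j).
Proof. by rewrite /= mem_slhomog vsval_gl_to_sl slproj_part. Qed.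

Lemma gl_to_sl_val (u : slA K m n) : gl_to_sl (vsval (u : subvs_of (slv K m n)))
    = u.
Proof.
rewrite /gl_to_sl slproj_id ?vsvalK //.
have := subvsP (u : subvs_of (slv K m n)); rewrite memv_ker lfunE /=; exact/eqP.
Qed.

Lemma gl_to_sl_br i j a b : lbr (gl_to_sl (delta_mx i j))
    (gl_to_sl (delta_mx a b)) =
  (j == a)%:R *: gl_to_sl (delta_mx i b)
  - (-1) ^+ ((row_parity i (+) row_parity j) && (row_parity a (+) row_parity b))
    *: ((i == b)%:R *: gl_to_sl (delta_mx a j)).
Proof.
rewrite -[LHS]gl_to_sl_val slbrE !vsval_gl_to_sl scomm_slproj.
by rewrite linearB !linearZ.
Qed.

(** The matrix units act through their projections to sl; scalar matrices are
    central, so the projection preserves brackets. *)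
Lemma has_type_mxaction : has_type F (slA K m n) ->
  exists E : R -> R -> 'End(F), mxaction row_parity E.
Proof.
case=> phi [ker0 lim hom brk].
exists (fun i j => phi (gl_to_sl (delta_mx i j))); split.
- by move=> i j; apply/hom/gl_to_sl_homog.
- move=> i j a b v.
  have := brk _ _ _ _ (gl_to_sl_homog i j) (gl_to_sl_homog a b);
      rewrite gl_to_sl_br.
  move=> /(congr1 (fun f : 'End(F) => f v)).
  rewrite linearB !linearZ /= !(add_lfunE, opp_lfunE, scale_lfunE, comp_lfunE)
      mulnb.
  move=> h; rewrite scalerDr -addrA [X in _ + X]addrC h scalerN.
  by rewrite addrC subrK.
- move=> v; rewrite -sum_lfunE -linear_sum -linear_sum /=.
  rewrite -mx1_sum_delta; suff -> : gl_to_sl 1%:M = 0 by rewrite linear0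
      zero_lfunE.
  rewrite /gl_to_sl /slproj supertrace1 divff ?sl_sdim_neq0 // subrr; exact:
      linear0.
- by move=> i j; apply/lim; apply: memv_img; apply: memvf.
- move=> f adf; have /lim/memv_imgP[u _ ->] : Inder f.
    exists [:: f]; split; last by rewrite memv_span1.
    by move=> g; rewrite inE => /eqP->.
  pose X := vsval (u : subvs_of (slv K m n)); exists (fun i j => X i j).
  rewrite -[u]gl_to_sl_val -/X [X in gl_to_sl X]matrix_sum_delta.
  rewrite !linear_sum; apply: eq_bigr => i _; rewrite !linear_sum.
  by apply: eq_bigr => j _; rewrite !linearZ.
- move=> i j ij; apply: contraNneq ij => E0.
  have : gl_to_sl (delta_mx i j) \in lker phi by rewrite memv_ker E0.
  rewrite ker0 memv0 => /eqP/(congr1 (fun u : subvs_of (slv K m n) =>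
      vsval u i j)).
  rewrite vsval_gl_to_sl linear0 !mxE !eqxx /=; case: eqP => // _.
  by rewrite mulr0n subr0 => /eqP; rewrite oner_eq0.
Qed.
End SlAction.

Theorem theorem4p2 (Phi : closedFieldType) (Phi0 : [pchar Phi] =i pred0)
    (m n : nat) (neq_mn : m <> n) :
  ~ exists (N : nat) (F : filippovSuperalgebra Phi N),
      [/\ (3 <= N)%N, fsimple F,
          homog F false <> 0%VS, homog F true <> 0%VS
        & has_type F (slA Phi m n)].
Proof.
case=> N [F [N3 simF F0 _ /(has_type_mxaction Phi0 neq_mn)[E act]]].
have unsplitb : bijective (@unsplit m.+1 n.+1) := Bijective (@unsplitK _ _)
    (@splitK _ _).
have row_parityE (x : 'I_m.+1 + 'I_n.+1) : row_parity (unsplit x) =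
    ~~ in_first x.
  by rewrite /row_parity unsplitK; case: x.
have [lt_mn|lt_nm|//] := ltngtP m n; last first.
  apply: (no_gl_action (t := false) _ Phi0 simF F0 N3 lt_nm).
  by apply: (mxaction_reindex unsplitb _ act) => x; rewrite row_parityE; case:
      x.
pose swap (A B : Type) (x : A + B) : B + A :=
  match x with inl a => inr a | inr b => inl b end.
have swapK A B : cancel (@swap A B) (@swap B A) by case.
have swapb : bijective (@swap 'I_n.+1 'I_m.+1) := Bijective (@swapK _ _)
    (@swapK _ _).
apply: (no_gl_action (t := true) _ Phi0 simF F0 N3 lt_mn).
by apply: (mxaction_reindex (bij_comp unsplitb swapb) _ act) => x; rewrite /=
    row_parityE; case: x.
Qed.
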